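(* Let $1\le p\le\infty$, $\kappa\in(1,2]$, $L,R,\epsilon>0$, and consider the problem class of unconstrained minimization with objectives in $\mathcal{F}_{\mathbb{R}^d,\|\cdot\|_p}(\kappa,L)$ whose minima are attained in the ball $\{\mathbf{x}:\|\mathbf{x}\|_p\le R\}$. Then the oracle complexity of achieving the dual norm of the gradient bounded by $\epsilon$ (i.e. of finding a query point $\mathbf{x}$ with $\|\nabla f(\mathbf{x})\|_{p_*}\le\epsilon$, $\frac1p+\frac1{p_*}=1$), for any local oracle, is bounded below by: (i) $\Omega\Big(\Big(\frac{LR^{\kappa-1}}{\epsilon[\ln d]^{\kappa-1}}\Big)^{\frac2{3\kappa-2}}\Big)$, if $1\le p<2$; (ii) $\Omega\Big(\Big(\frac{LR^{\kappa-1}}{\epsilon\min\{p,\ln d\}^{\kappa-1}}\Big)^{\frac{p}{\kappa p+\kappa-p}}\Big)$, if $2\le p<\infty$; and (iii) $\Omega\Big(\Big(\frac{LR^{\kappa-1}}{\epsilon[\ln d]^{\kappa-1}}\Big)^{\frac1{\kappa-1}}\Big)$, if $p=\infty$. The dimension $d$ for the lower bound to hold must be at least as large as the lower bound itself.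
   Context: $\mathcal{F}_{\mathbb{R}^d,\|\cdot\|_p}(\kappa,L)$ is the class of convex functions $f:\mathbb{R}^d\to\mathbb{R}$ that are $(L,\kappa)$-weakly smooth: $\|\nabla f(\mathbf{x})-\nabla f(\mathbf{y})\|_{p_*}\le L\|\mathbf{x}-\mathbf{y}\|_p^{\kappa-1}$ for all $\mathbf{x},\mathbf{y}$. An oracle for a function class $\mathcal{F}$ is a map $\mathcal{O}:\mathcal{F}\times\mathbb{R}^d\to\mathbf{F}$, with $\mathbf{F}$ a vector space; it is local if $\mathcal{O}(f,\mathbf{x})=\mathcal{O}(g,\mathbf{x})$ whenever $f,g\in\mathcal{F}$ coincide on a neighborhood of $\mathbf{x}$ (e.g. the gradient oracle $\mathcal{O}(f,\mathbf{x})=\nabla f(\mathbf{x})$). An algorithm $\mathcal{A}$ is a sequence of functions $(\mathcal{A}_k)$ producing query points $\mathbf{x}^{k+1}=\mathcal{A}_{k+1}(\mathbf{x}^0,\mathcal{O}(f,\mathbf{x}^0),\ldots,\mathbf{x}^k,\mathcal{O}(f,\mathbf{x}^k))$; here its running time is $T(\mathcal{A},f,\epsilon)=\inf\{k\ge0:\|\nabla f(\mathbf{x}^k)\|_{p_*}\le\epsilon\}$, and the oracle complexity is $\inf_{\mathcal{A}}\sup_{f}T(\mathcal{A},f,\epsilon)$, the supremum being over the objectives $f$ in the problem class. *)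

(* Defs.v *)
From HB Require Import structures.
From mathcomp Require Export all_boot all_order all_algebra.
From mathcomp Require Export all_classical all_reals all_analysis.
Export Order.TTheory GRing.Theory Num.Theory.
Export numFieldNormedType.Exports.

Set Implicit Arguments.
Unset Strict Implicit.
Unset Printing Implicit Defensive.

Local Open Scope classical_set_scope.
Local Open Scope ring_scope.

Section WeakSmoothness.
Context {R : realType} {d : nat}.
Implicit Types (f : 'rV[R]_d -> R) (x : 'rV[R]_d) (p : \bar R).

(* The l_p norm on R^d for 1 <= p <= +oo; the value at p = -oo is junk. *)
Definition lpnorm p x : R :=
  match p with
  | r%:E => (\sum_(i < d) `|x 0 i| `^ r) `^ r^-1
  | +oo%E => \big[Num.max/0]_(i < d) `|x 0 i|
  | -oo%E => 0
  end.

Definition dual_lpnorm p x : R := lpnorm (hoelder_conjugate p) x.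

(* The partial derivatives are meaningful only where [f] is differentiable. *)
Definition grad f x : 'rV[R]_d := \row_(i < d) 'D_(delta_mx 0 i) f x.

Definition weakly_smooth_convex p (kappa L : R) : set ('rV[R]_d -> R) :=
  [set f | [/\ convex_function [set: 'rV[R]_d] f,
               forall x, differentiable f x &
               forall x y, dual_lpnorm p (grad f x - grad f y) <=
                           L * lpnorm p (x - y) `^ (kappa - 1)]].

Definition min_attained_in_ball p (Rad : R) : set ('rV[R]_d -> R) :=
  [set f | exists2 x, lpnorm p x <= Rad & forall y, f x <= f y].

End WeakSmoothness.

Section OracleComplexity.
Context {R : realType} {d : nat} {V : Type}.
Implicit Types (f : 'rV[R]_d -> R) (O : ('rV[R]_d -> R) -> 'rV[R]_d -> V).

(* An oracle for the class [F] is represented by a total map whose values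
   outside [F] are never used. *)
Definition local_oracle (F : set ('rV[R]_d -> R)) O :=
  forall f g x, F f -> F g ->
    (\forall y \near nbhs x, f y = g y) -> O f x = O g x.

(* [A k] maps the first [k] query/answer pairs to the query point [x^k];
   in particular [A 0] gives a starting point independent of the objective. *)
Definition algorithm :=
  forall k : nat, k.-tuple ('rV[R]_d * V) -> 'rV[R]_d.

Fixpoint transcript O f (A : algorithm) (k : nat) : k.-tuple ('rV[R]_d * V) :=
  match k with
  | 0%N => [tuple]
  | k'.+1 => let h := transcript O f A k' in
             [tuple of rcons h (A k' h, O f (A k' h))]
  end.

Definition query O f (A : algorithm) (k : nat) : 'rV[R]_d :=
  A k (transcript O f A k).

(* Infimum over the empty set: the value is [+oo] when the gradient never
   becomes small along the query points. *)
Definition running_time p O f (A : algorithm) (eps : R) : \bar R :=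
  ereal_inf [set k%:R%:E | k in
    [set k : nat | dual_lpnorm p (grad f (query O f A k)) <= eps]].

Definition oracle_complexity p (P : set ('rV[R]_d -> R)) O (eps : R) : \bar R :=
  ereal_inf (range (fun A : algorithm =>
    ereal_sup [set running_time p O f A eps | f in P])).

End OracleComplexity.

(* Main.v *)
From HB Require Import structures.
Require Import Defs.
From mathcomp Require Import ring lra.

(** The hard instances are built piece by piece against the algorithm. Let
    z_1, ..., z_n be vectors (n <= d) such that every choice of signs sg has a witness w
    in the unit ball of l_p with <z_i, w> = sg_i * mu for all i. The objective is a
    smoothing, of range delta, of
      x |-> max (max_j (<v_j, x> - 2 j delta), - 2 n delta),
    where v_j is a signed vector z_i fixed at the j-th query: among the unused vectors
    it is the one with the largest absolute pairing with the query point, with the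
    sign that makes the pairing nonnegative. Around that point all pieces chosen
    later stay below the j-th one by more than delta, whatever the later queries are, so
    a local oracle cannot tell the final objective from the one built so far
    ([hard_rcons_near], [resisting_signs]). The floor - 2 n delta is also inactive, so
    at each of the n queries the gradient is a convex combination of the v_j, up to
    the scale s of the function; paired with the witness w of the chosen signs it gives
    s * mu, and its dual norm is at least that large ([dual_hard_grad_ge]). At
    - Rad * w only the floor is active as soon as (2 n + 1) delta <= Rad * mu, so the
    minimum is attained in the ball ([hard_min_attained]).

    The smoothed maximum of u ([smax]) is
      min_t t + delta / (k+2) * sum_i ((u_i - t)_+ / delta)^(k+2).
    Its gradient is the probability vector ((u_i - t)_+ / delta)^(k+1) with t
    the minimizer, which ignores all u_i below max u - delta, and it is Lipschitz from
    l_(2k+2) to the dual space with constant 3 (k+1) / delta, whatever the number of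
    coordinates ([weight_lipschitz]). Interpolation with the trivial bound 2
    yields the Hoelder condition of exponent kappa - 1 ([weight_hoelder]). The norm
    l_(2k+2) is at most l_p if p <= 2k+2, and at most e times the maximum norm if
    ln d <= k+1; this is where the factor min (p, ln d) comes from.

    For p >= 2 the z_i are canonical basis vectors, and mu = n^(-1/p). For p < 2 they
    are rows of the discrete Hartley transform, flat and orthogonal in every
    dimension, and mu is of order n^(-1/2). With delta of order Rad * mu / n and s of
    order L (delta / k)^(kappa - 1), the condition s * mu > eps reads, up to constants,
      n^(kappa - 1) * mu^(- kappa) < L Rad^(kappa - 1) / (eps k^(kappa - 1)),
    and solving it for n gives the three exponents ([complexity_ge]). *)

Set Implicit Arguments.
Unset Strict Implicit.
Unset Printing Implicit Defensive.
Local Open Scope classical_set_scope.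
Local Open Scope ring_scope.

(** * A smoothed maximum *)

Section PowerInequalities.
Variable R : realDomainType.
Implicit Types a b : R.

Lemma exprS_tangent n a b : 0 <= a -> 0 <= b ->
  a ^+ n.+1 + n.+1%:R * a ^+ n * (b - a) <= b ^+ n.+1.
Proof.
move=> a0 b0; elim: n => [|n IHn]; first by rewrite !expr1 expr0; lra.
have h1 := ler_wpM2l b0 IHn.
rewrite [b ^+ n.+2]exprS; apply: le_trans h1.
have h : 0 <= n.+1%:R * a ^+ n * (b - a) ^+ 2.
  by rewrite mulr_ge0 ?sqr_ge0// mulr_ge0// exprn_ge0.
rewrite -subr_ge0; apply: le_trans h _.
rewrite le_eqVlt; apply/orP; left; apply/eqP.
rewrite !exprS -[n.+2]addn1 natrD; ring.
Qed.

(** For [b <= a] the increment of the power is at most [n.+1 * a ^+ n * (a - b)],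
    by the tangent inequality at [a]; multiplying by the increment itself gives the
    symmetric form, in which neither variable has to be the larger one. *)
Lemma sqr_subX_le n a b : 0 <= a -> 0 <= b ->
  (a ^+ n.+1 - b ^+ n.+1) ^+ 2 <=
  n.+1%:R * Num.max a b ^+ n * ((a ^+ n.+1 - b ^+ n.+1) * (a - b)).
Proof.
wlog ba : a b / b <= a => [hw a0 b0|a0 b0].
  case/orP: (le_total b a) => [ba|ab]; first exact: hw.
  have := hw b a ab b0 a0; rewrite maxC.
  by rewrite -sqrrN opprB -[X in _ <= _ * X]mulrNN !opprB.
rewrite max_l//.
have tang := exprS_tangent n a0 b0.
have D0 : 0 <= a ^+ n.+1 - b ^+ n.+1 by rewrite subr_ge0 lerXn2r.
rewrite expr2 mulrC mulrCA ler_wpM2l//; nra.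
Qed.

(** A crude form of Young's inequality: the left side is at most the larger of the
    two powers on the right. *)
Lemma mulX_sqr_le n (m y : R) : 0 <= m ->
  m ^+ n * y ^+ 2 <= m ^+ n.+1 + y ^+ (n.+1).*2.
Proof.
move=> m0; rewrite -mul2n exprM; set z := y ^+ 2.
have z0 : 0 <= z by rewrite sqr_ge0.
have [mz|/ltW zm] := leP m z.
  apply: (@le_trans _ _ (z ^+ n.+1)); last by rewrite lerDr exprn_ge0.
  by rewrite exprSr ler_wpM2r// lerXn2r.
apply: (@le_trans _ _ (m ^+ n.+1)); last by rewrite lerDl exprn_ge0.
by rewrite exprSr ler_wpM2l// exprn_ge0.
Qed.

End PowerInequalities.

Section SmoothMax.
Variables (R : realType) (I : finType) (k : nat) (delta : R).
Hypothesis delta_gt0 : 0 < delta.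
Implicit Types (u v h : I -> R) (t T : R).

Definition excess u t i := Num.max 0 ((u i - t) / delta).

(** The minimizing [t] in the description of [smax]. *)
Definition level u : R :=
  xget 0 [set t | \sum_i excess u t i ^+ k.+1 = 1].

(** The gradient of [smax]. *)
Definition weight u i := excess u (level u) i ^+ k.+1.

(** This is the minimum over [t] of
    t + delta / (k + 2) * \sum_i (excess u t i) ^ (k + 2):
    the derivative in [t] vanishes exactly when the powers [excess u t i ^+ k.+1]
    add up to 1. *)
Definition smax u :=
  level u + delta / k.+2%:R * \sum_i excess u (level u) i ^+ k.+2.

Lemma excess_ge0 u t i : 0 <= excess u t i.
Proof. by rewrite /excess le_max lexx. Qed.

Lemma weight_ge0 u i : 0 <= weight u i.
Proof. by rewrite exprn_ge0// excess_ge0. Qed.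

Lemma excess_ge u t i : u i - t <= delta * excess u t i.
Proof. by rewrite mulrC -ler_pdivrMr// /excess le_max lexx orbT. Qed.

Lemma excess_eq u t i : 0 < excess u t i -> delta * excess u t i = u i - t.
Proof.
rewrite /excess; case: (leP ((u i - t) / delta) 0) => h; first by rewrite ltxx.
by rewrite mulrCA divff ?mulr1 ?gt_eqF.
Qed.

Lemma excess0 u t i : u i <= t -> excess u t i = 0.
Proof.
by move=> ut; rewrite /excess max_l// ler_pdivrMr// mul0r subr_le0.
Qed.

Lemma continuous_excess_sum u :
  continuous (fun t : R => \sum_i excess u t i ^+ k.+1).
Proof.
apply: continuous_big => [|i _ t]; first exact: add_continuous.
have c : {for t, continuous (fun x => excess u x i)}.
  apply: (@continuous_max _ _ (cst 0) (fun x : R => (u i - x) / delta : R^o)).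
    exact: cvg_cst.
  by apply: cvgMr_tmp; apply: cvgB; [exact: cvg_cst|exact: cvg_id].
exact: (continuous_comp c (@exprn_continuous _ k.+1 _)).
Qed.

Lemma sum_weight (i0 : I) u : \sum_i weight u i = 1.
Proof.
rewrite /weight /level; case: xgetP => [t _ ->//|none].
pose phi t := \sum_i excess u t i ^+ k.+1.
pose a := u i0 - delta; pose b := \sum_i `|u i|.
have ub i : u i <= b.
  by rewrite /b (bigD1 i)//= (le_trans (ler_norm _))// lerDl sumr_ge0.
have ab : a <= b by rewrite /a; have := ub i0; move: delta_gt0; lra.
have phia : 1 <= phi a.
  have e1 : excess u a i0 = 1.
    have -> : excess u a i0 = Num.max 0 1.
      by congr Num.max; rewrite /a; field; rewrite gt_eqF.
    by rewrite max_r.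
  rewrite /phi (bigD1 i0)//= e1 expr1n lerDl sumr_ge0// => i _.
  by rewrite exprn_ge0// excess_ge0.
have phib : phi b = 0.
  by rewrite /phi big1// => i _; rewrite excess0// expr0n.
have : Num.min (phi a) (phi b) <= 1 <= Num.max (phi a) (phi b).
  by rewrite ge_min le_max phia phib ler01 orbT.
move/(IVT ab (continuous_subspaceT (@continuous_excess_sum u))) => [t _ ht].
by have := none t ht.
Qed.

Lemma level_ge u i : u i - delta <= level u.
Proof.
have w1 : weight u i <= 1.
  by rewrite -(sum_weight i u) (bigD1 i)//= lerDl sumr_ge0// => j _; exact: weight_ge0.
have : excess u (level u) i <= 1.
  rewrite leNgt; apply/negP => e1; move: w1.
  by rewrite leNgt /weight exprn_egt1.
have := excess_ge u (level u) i; move: delta_gt0; nra.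
Qed.

(** The smoothing is local: since all weights are at most 1, the level is at least
    the maximum minus [delta], and what lies below the level has weight 0. *)
Lemma weight_eq0 u i j : u j <= u i - delta -> weight u j = 0.
Proof. by move=> uji; rewrite /weight excess0 ?expr0n// (le_trans uji)// level_ge. Qed.

(** The tangent inequality for the power [k.+2], summed over [i]; the difference of
    the levels is absorbed because the weights sum to 1. *)
Lemma smax_subgradient (i0 : I) u v :
  smax u + \sum_i weight u i * (v i - u i) <= smax v.
Proof.
rewrite /smax; set t := level u; set t' := level v.
have -> : \sum_i weight u i * (v i - u i) =
    t' - t + \sum_i weight u i * ((v i - t') - (u i - t)).
  rewrite -[t' - t]mul1r -(sum_weight i0 u) mulr_suml -big_split/=.
  by apply: eq_bigr => i _; ring.
suff : delta / k.+2%:R * (\sum_i excess u t i ^+ k.+2) +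
    \sum_i weight u i * (v i - t' - (u i - t)) <=
    delta / k.+2%:R * \sum_i excess v t' i ^+ k.+2.
  set A := delta / _ * (\sum_i excess u t i ^+ _).
  set B := \sum_i weight u i * _; set C := delta / _ * _.
  by clearbody A B C; lra.
rewrite !mulr_sumr -big_split/=; apply: ler_sum => i _.
have a0 := excess_ge0 u t i; have b0 := excess_ge0 v t' i.
set a := excess u t i in a0 *; set b := excess v t' i in b0 *.
have tang := exprS_tangent k.+1 a0 b0.
have c0 : 0 <= delta / k.+2%:R by rewrite divr_ge0// ltW.
have := ler_wpM2l c0 tang; rewrite mulrDr; apply: le_trans; rewrite lerD2l.
have -> : delta / k.+2%:R * (k.+2%:R * a ^+ k.+1 * (b - a)) =
          a ^+ k.+1 * (delta * b - delta * a).
  rewrite -[k.+2%:R * _ * _]mulrA [LHS]mulrA divfK ?pnatr_eq0//; ring.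
rewrite /weight -/a; have [->|a_gt0] := eqVneq a 0; first by rewrite expr0n !mul0r.
have {}a_gt0 : 0 < a by rewrite lt0r a_gt0.
rewrite ler_wpM2l ?exprn_ge0// (excess_eq a_gt0) lerD2r.
exact: excess_ge.
Qed.

(** Values of weight 0 contribute nothing to the subgradient inequality between
    [u] and [v], which then holds in both directions without a linear term. *)
Lemma smax_eq (i0 : I) u v :
  (forall i, u i = v i \/ weight u i = 0 /\ weight v i = 0) -> smax u = smax v.
Proof.
move=> uv; apply/eqP; rewrite eq_le.
have := smax_subgradient i0 u v.
have := smax_subgradient i0 v u.
rewrite !big1 ?addr0 => [-> ->//|i _|i _].
  by case: (uv i) => [->|[-> _]]; rewrite ?subrr ?mulr0 ?mul0r.
by case: (uv i) => [->|[_ ->]]; rewrite ?subrr ?mulr0 ?mul0r.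
Qed.

(** The monotonicity gap of the excesses. It bounds the change of the weights from
    above ([pairing_le]) and is bounded by the pairing of that change with [u - v]
    ([gap_le]); together they give the Lipschitz estimate. *)
Let gap u v := \sum_i (weight u i - weight v i) *
  (excess u (level u) i - excess v (level v) i).

(** The weights have the same sum for [u] and [v], so the levels may be subtracted
    from [u] and [v] for free. Where the excess vanishes, [u i] is below the level
    and the sign of the weight difference makes the replacement an inequality. *)
Lemma gap_le (i0 : I) u v :
  delta * gap u v <= \sum_i (weight u i - weight v i) * (u i - v i).
Proof.
rewrite /gap; set t := level u; set t' := level v.
have -> : \sum_i (weight u i - weight v i) * (u i - v i) =
    \sum_i (weight u i - weight v i) * ((u i - t) - (v i - t')).
  have tsum0 : (t' - t) * \sum_i (weight u i - weight v i) = 0.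
    by rewrite sumrB !(sum_weight i0) subrr mulr0.
  rewrite -[LHS]addr0 -[X in _ + X]tsum0 mulr_sumr -big_split/=.
  by apply: eq_bigr => i _; ring.
rewrite mulr_sumr; apply: ler_sum => i _; rewrite mulrCA /weight -/t -/t'.
have [ua va] := (excess_ge u t i, excess_ge v t' i).
have [a0 b0] := (excess_ge0 u t i, excess_ge0 v t' i).
have ea := @excess_eq u t i; have eb := @excess_eq v t' i.
move: ea eb ua va a0 b0; set a := excess u t i; set b := excess v t' i.
move=> ea eb ua va a0 b0.
have [A0 B0] : 0 <= a ^+ k.+1 /\ 0 <= b ^+ k.+1 by rewrite !exprn_ge0.
move: a0; rewrite le_eqVlt => /orP[/eqP a0|/ea {}ea].
  move: b0; rewrite le_eqVlt => /orP[/eqP b0|/eb {}eb].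
    by rewrite -a0 -b0 subrr !mul0r.
  by rewrite -a0 expr0n/= in ua A0 *; nra.
move: b0; rewrite le_eqVlt => /orP[/eqP b0|/eb {}eb].
  by rewrite -b0 expr0n/= in va B0 *; nra.
by rewrite -ea -eb; lra.
Qed.

(** Termwise, the square of the weight difference is at most
    (k + 1) * m ^ k times the corresponding term of [gap], where m is the larger
    excess. After an arithmetic-geometric split with parameter [lam] the factor
    m ^ k * h ^ 2 remains; its sum is bounded by 3 * T ^ 2 because the powers
    m ^ (k + 1) add up to at most 2. No dependence on the number of indices
    appears. *)
Lemma pairing_le (i0 : I) u v h T lam : 0 < T -> 0 < lam ->
  \sum_i h i ^+ (k.+1).*2 <= T ^+ (k.+1).*2 ->
  2 * `|\sum_i (weight u i - weight v i) * h i| <=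
    lam * gap u v + 3 * k.+1%:R * T ^+ 2 / lam.
Proof.
move=> T0 lam0 hT.
pose a i := excess u (level u) i; pose b i := excess v (level v) i.
pose m i := Num.max (a i) (b i).
have m0 i : 0 <= m i by rewrite le_max excess_ge0.
have term i : 2 * `|(weight u i - weight v i) * h i| <=
    lam * ((weight u i - weight v i) * (a i - b i)) +
    k.+1%:R * T ^+ 2 / lam * (weight u i + weight v i + (h i / T) ^+ (k.+1).*2).
  have sq := sqr_subX_le k (excess_ge0 u (level u) i) (excess_ge0 v (level v) i).
  have mx : m i ^+ k.+1 <= weight u i + weight v i.
    rewrite /m /weight -/(a i) -/(b i); have [ab|ab] := leP (a i) (b i).
      by rewrite lerDr exprn_ge0// excess_ge0.
    by rewrite lerDl exprn_ge0// excess_ge0.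
  have yg := mulX_sqr_le k (h i / T) (m0 i).
  set y := h i / T in yg *; have -> : h i = y * T by rewrite /y divfK ?gt_eqF.
  have {mx}yg : m i ^+ k * y ^+ 2 <= weight u i + weight v i + y ^+ (k.+1).*2.
    by rewrite (le_trans yg)// lerD2r.
  move: sq; rewrite -/(a i) -/(b i) -/(weight u i) -/(weight v i) -/(m i).
  set D := weight u i - weight v i; set e := a i - b i.
  move: yg; set W := _ + _ + _; move=> yg sq.
  have c0 : 0 <= k.+1%:R * T ^+ 2 / lam.
    by rewrite divr_ge0 ?(ltW lam0)// mulr_ge0// sqr_ge0.
  have := ler_wpM2l c0 yg; rewrite -(lerD2l (lam * (D * e))); apply: le_trans.
  set c := k.+1%:R in sq c0 *; set M := m i ^+ k in sq yg *.
  have cM : 0 <= c * M by rewrite mulr_ge0// exprn_ge0.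
  have De : 0 <= D * e.
    rewrite /D /e /weight -/(a i) -/(b i).
    have [ab|/ltW ab] := leP (a i) (b i).
      rewrite mulr_le0// subr_le0//.
      by rewrite lerXn2r// ?nnegrE excess_ge0.
    by rewrite mulr_ge0// subr_ge0// lerXn2r// ?nnegrE excess_ge0.
  have R0 : 0 <= lam * (D * e) + c * T ^+ 2 / lam * (M * y ^+ 2).
    by rewrite addr_ge0// mulr_ge0 ?(ltW lam0)// mulr_ge0 ?sqr_ge0// exprn_ge0.
  rewrite -ler_sqr ?nnegrE ?mulr_ge0//.
  rewrite exprMn real_normK ?num_real//.
  have -> : c * T ^+ 2 / lam * (M * y ^+ 2) = (c * M) * (y * T) ^+ 2 / lam.
    by ring.
  set P := c * M in sq cM *; set z := y * T.
  have x0 : 0 <= lam * (D * e) by rewrite mulr_ge0// ltW.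
  apply: (@le_trans _ _ (4 * ((lam * (D * e)) * (P * z ^+ 2 / lam)))).
    have -> : lam * (D * e) * (P * z ^+ 2 / lam) = P * (D * e) * z ^+ 2.
      by field; rewrite gt_eqF.
    rewrite exprMn; have -> : (2 : R) ^+ 2 = 4 by ring.
    rewrite ler_pM2l ?ltr0n// ler_wpM2r ?sqr_ge0//.
  set X := lam * _; set Y := P * _ / _; have := sqr_ge0 (X - Y); nra.
apply: (@le_trans _ _ (\sum_i 2 * `|(weight u i - weight v i) * h i|)).
  by rewrite -mulr_sumr ler_wpM2l// ler_norm_sum.
apply: (le_trans (ler_sum _ (fun i _ => term i))).
rewrite big_split/= -!mulr_sumr lerD2l.
rewrite -[leRHS]mulrA.
have -> : 3 * k.+1%:R * (T ^+ 2 / lam) = k.+1%:R * T ^+ 2 / lam * 3 by ring.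
rewrite ler_wpM2l//.
  by rewrite divr_ge0 ?(ltW lam0)// mulr_ge0// sqr_ge0.
rewrite !big_split/= !(sum_weight i0).
suff : \sum_i (h i / T) ^+ k.+1.*2 <= 1 by lra.
under eq_bigr do rewrite exprMn exprVn.
by rewrite -mulr_suml ler_pdivrMr ?exprn_gt0// mul1r.
Qed.

(** Taking [h = u - v] and [lam = delta] in [pairing_le] bounds [gap]; this bound is
    fed back into [pairing_le], with the [lam] that balances its two terms. *)
Lemma weight_lipschitz (i0 : I) u v h T T' : 0 < T -> 0 < T' ->
  \sum_i h i ^+ (k.+1).*2 <= T ^+ (k.+1).*2 ->
  \sum_i (u i - v i) ^+ (k.+1).*2 <= T' ^+ (k.+1).*2 ->
  `|\sum_i (weight u i - weight v i) * h i| <= 3 * k.+1%:R * T * T' / delta.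
Proof.
move=> T0 T'0 hT uvT'.
have S := gap_le i0 u v.
have P1 := pairing_le i0 u v T'0 delta_gt0 uvT'.
have S2 : gap u v <= 3 * k.+1%:R * T' ^+ 2 / delta ^+ 2.
  rewrite expr2 invfM !mulrA ler_pdivlMr// mulrC.
  have := ler_norm (\sum_i (weight u i - weight v i) * (u i - v i)).
  lra.
have lam0 : 0 < delta * T / T' by rewrite divr_gt0// mulr_gt0.
have P2 := pairing_le i0 u v T0 lam0 hT.
have := ler_wpM2l (ltW lam0) S2.
have -> : delta * T / T' * (3 * k.+1%:R * T' ^+ 2 / delta ^+ 2) =
          3 * k.+1%:R * T * T' / delta by field; rewrite !gt_eqF.
have e : 3 * k.+1%:R * T ^+ 2 / (delta * T / T') = 3 * k.+1%:R * T * T' / delta.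
  by field; rewrite !gt_eqF.
rewrite e in P2; lra.
Qed.

Lemma weight_diff_le (i0 : I) u v h T :
  (forall i, `|h i| <= T) ->
  `|\sum_i (weight u i - weight v i) * h i| <= 2 * T.
Proof.
move=> hT; apply: (le_trans (ler_norm_sum _ _ _)).
have -> : 2 * T = \sum_i (weight u i + weight v i) * T.
  by rewrite -mulr_suml big_split/= !(sum_weight i0); ring.
apply: ler_sum => i _; rewrite normrM ler_pM//.
rewrite (le_trans (ler_normB _ _))// !ger0_norm//; exact: weight_ge0.
Qed.

(** Interpolation between the Lipschitz estimate and the trivial bound [2 * T]. *)
Lemma weight_hoelder (i0 : I) u v h T T' kappa : 0 < T -> 0 < T' ->
  1 < kappa <= 2 ->
  \sum_i h i ^+ (k.+1).*2 <= T ^+ (k.+1).*2 ->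
  \sum_i (u i - v i) ^+ (k.+1).*2 <= T' ^+ (k.+1).*2 ->
  `|\sum_i (weight u i - weight v i) * h i| <=
    2 * T * (3 * k.+1%:R * T' / delta) `^ (kappa - 1).
Proof.
move=> T0 T'0 /andP[k1 k2] hT uvT'.
have L1 := weight_lipschitz i0 T0 T'0 hT uvT'.
have hiT i : `|h i| <= T.
  have : h i ^+ (k.+1).*2 <= T ^+ (k.+1).*2.
    apply: le_trans hT; rewrite (bigD1 i)//= lerDl sumr_ge0// => j _.
    by rewrite -mul2n exprM exprn_ge0// sqr_ge0.
  rewrite -mul2n !exprM -[in X in X -> _](real_normK (num_real (h i))) -!exprM.
  by rewrite ler_pXn2r// ?nnegrE// ltW.
have L2 := weight_diff_le i0 u v hiT.
set X := 3 * k.+1%:R * T' / delta.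
have X0 : 0 < X by rewrite divr_gt0// mulr_gt0// mulr_gt0// ltr0n.
have [X1|X1] := leP X 1.
  apply: (le_trans L1).
  have -> : 3 * k.+1%:R * T * T' / delta = T * X by rewrite /X; ring.
  have : X <= X `^ (kappa - 1).
    by apply: ger1_powR; rewrite ?X0//; lra.
  have := powR_ge0 X (kappa - 1); nra.
apply: (le_trans L2); rewrite ler_peMr//; first lra.
by rewrite -[leLHS](powRr0 X); apply: ler_powR; lra.
Qed.

End SmoothMax.

(** * Functions with a Hoelder continuous field of subgradients *)

Section Dot.
Variables (R : realType) (d : nat).
Implicit Types (g h x y : 'rV[R]_d) (f : 'rV[R]_d -> R).

Definition dot g h : R := \sum_i g 0 i * h 0 i.

Lemma dotC g h : dot g h = dot h g.
Proof. by apply: eq_bigr => i _; rewrite mulrC. Qed.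

Fact dot_is_linear g : linear (dot g : _ -> R^o).
Proof.
move=> a x y; rewrite /dot scaler_sumr -big_split/=.
by apply: eq_bigr => i _; rewrite !mxE mulrDr /GRing.scale/= mulrCA.
Qed.

HB.instance Definition _ g :=
  GRing.isLinear.Build R _ R^o _ (dot g) (dot_is_linear g).

Lemma dot0l h : dot 0 h = 0. Proof. by rewrite dotC linear0. Qed.
Lemma dotBl a b h : dot (a - b) h = dot a h - dot b h.
Proof. by rewrite dotC linearB/= ![dot h _]dotC. Qed.
Lemma dotZl c a h : dot (c *: a) h = c * dot a h.
Proof. by rewrite dotC linearZ/= dotC. Qed.
Lemma dotZr c a h : dot a (c *: h) = c * dot a h.
Proof. exact: linearZ. Qed.
Lemma dot_suml (I : finType) (a : I -> 'rV[R]_d) h :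
  dot (\sum_i a i) h = \sum_i dot (a i) h.
Proof. by rewrite dotC linear_sum; apply: eq_bigr => i _; rewrite /= dotC. Qed.
Lemma dot_delta g i : dot g (delta_mx 0 i) = g 0 i.
Proof.
rewrite /dot (bigD1 i)//= big1 => [|j /negPf ji]; rewrite !mxE ?eqxx ?addr0 ?mulr1//.
by rewrite ji andbF mulr0.
Qed.

Lemma continuous_dot g : continuous (dot g : 'rV[R]_d -> R^o).
Proof.
apply: continuous_big => [|i _ x]; first exact: add_continuous.
apply: (@continuousM _ _ (cst (g 0 i)) (fun h : 'rV[R]_d => h 0 i)).
  exact: cst_continuous.
exact: coord_continuous.
Qed.

Lemma convex_of_subgradient f (g : 'rV[R]_d -> 'rV[R]_d) :
  (forall x y, f x + dot (g x) (y - x) <= f y) ->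
  convex_function [set: 'rV[R]_d] f.
Proof.
move=> sub t x y _ _.
rewrite convRE; set z := (X in f X <= _).
have zE : z = t%:num *: x + (1 - t%:num) *: y by [].
have hx := sub z x; have hy := sub z y.
have t0 : 0 <= t%:num by [].
have t1 : t%:num <= 1 by [].
have : t%:num * dot (g z) (x - z) + (1 - t%:num) * dot (g z) (y - z) = 0.
  rewrite -!dotZr -linearD/= (_ : _ + _ = 0) ?linear0//.
  by apply/rowP => i; rewrite zE !mxE; ring.
rewrite -[unstable.onem _]/(1 - t%:num).
move: (f z) (f x) (f y) (dot _ _) (dot _ _) (t%:num) t0 t1 hx hy.
by move=> a b c e1 e2 s *; nra.
Qed.

(** Adding the subgradient inequalities at [x] and [y] squeezes the linearization
    error between 0 and the pairing of [g y - g x] with [y - x], which is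
    o(|y - x|). *)
Lemma grad_of_subgradient f (g : 'rV[R]_d -> 'rV[R]_d) (C kappa : R) x :
  1 < kappa -> 0 <= C ->
  (forall x y, f x + dot (g x) (y - x) <= f y) ->
  (forall x y, dot (g y - g x) (y - x) <= C * `|y - x| `^ kappa) ->
  differentiable f x /\ grad f x = g x.
Proof.
move=> k1 C0 sub hol.
have expansion : (f \o shift x) =
    cst (f x) + (dot (g x) : _ -> R^o) +o_ (0 : 'rV[R]_d) id.
  apply/eqaddoP => _/posnumP[e].
  have E0 : 0 < e%:num / (C + 1) by rewrite divr_gt0 ?ltr_wpDl.
  have nb := @nbhs0_le _ ('rV[R]_d : normedModType R) _ (powR_gt0 (kappa - 1)^-1 E0).
  near=> h.
  rewrite /= [X in `|X|](_ : _ = f (h + x) - f x - dot (g x) h); last first.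
    by rewrite !fctE /= opprD addrA.
  have s1 := sub x (h + x); rewrite addrK in s1.
  have s2 := sub (h + x) x; have hh := hol x (h + x).
  rewrite addrK dotBl in hh.
  rewrite opprD addrCA subrr addr0 linearN/= in s2.
  rewrite ger0_norm; last by lra.
  apply: (@le_trans _ _ (C * `|h| `^ kappa)); first by lra.
  have -> : `|h| `^ kappa = `|h| * `|h| `^ (kappa - 1).
    by rewrite mulr_powRB1//; lra.
  rewrite mulrCA mulrC ler_wpM2r//.
  have : `|h| `^ (kappa - 1) <= e%:num / (C + 1).
    have hr : `|h| <= (e%:num / (C + 1)) `^ (kappa - 1)^-1.
      by near: h; exact: nb.
    have k0 : 0 <= kappa - 1 by lra.
    apply: (le_trans (ge0_ler_powR k0 _ _ hr)); rewrite ?nnegrE ?powR_ge0//.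
    by rewrite -powRrM mulVf ?powRr1 ?(ltW E0)// gt_eqF//; lra.
  rewrite ler_pdivlMr ?ltr_wpDl//.
  have := powR_ge0 `|h| (kappa - 1); nra.
have dfE := diff_unique (@continuous_dot (g x)) expansion.
have df : differentiable f x.
  apply/diff_locallyP; rewrite dfE; split; [exact: continuous_dot|exact: expansion].
split=> //; apply/rowP => i; rewrite !mxE deriveE// dfE; exact: dot_delta.
Unshelve. all: by end_near.
Qed.
End Dot.

(** * The l_p norm and its dual *)

Section LpNorm.
Variables (R : realType) (d : nat).
Implicit Types (g h x y : 'rV[R]_d) (p : \bar R) (r : R).

Lemma lpnorm_ge0 p x : 0 <= lpnorm p x.
Proof.
case: p => [r| |]//=; first exact: powR_ge0.
exact: bigmax_ge_id.
Qed.

Lemma powRVK r (a : R) : 0 < r -> 0 <= a -> (a `^ r^-1) `^ r = a.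
Proof. by move=> r0 a0; rewrite -powRrM mulVf ?gt_eqF// powRr1. Qed.

Lemma powRKV r (a : R) : 0 < r -> 0 <= a -> (a `^ r) `^ r^-1 = a.
Proof. by move=> r0 a0; rewrite -powRrM mulfV ?gt_eqF// powRr1. Qed.

Lemma lpnorm_powR r x : 0 < r ->
  lpnorm r%:E x `^ r = \sum_i `|x 0 i| `^ r.
Proof. by move=> r0; rewrite /= powRVK// sumr_ge0// => i _; exact: powR_ge0. Qed.

Lemma lpnorm_le r x (M : R) : 0 < r -> 0 <= M ->
  \sum_i `|x 0 i| `^ r <= M `^ r -> lpnorm r%:E x <= M.
Proof.
move=> r0 M0 h; rewrite -[leRHS](powRKV r0 M0) /=; apply: ge0_ler_powR => //.
- by rewrite invr_ge0 ltW.
- by rewrite nnegrE sumr_ge0// => i _; exact: powR_ge0.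
- by rewrite nnegrE powR_ge0.
Qed.

Lemma coord_le_lpnorm p x i : (1 <= p)%E -> `|x 0 i| <= lpnorm p x.
Proof.
case: p => [r| |]//=.
  rewrite lee_fin => r1; have r0 : 0 < r by lra.
  rewrite -[leLHS](powRKV r0)//; apply: ge0_ler_powR => //.
  - by rewrite invr_ge0 ltW.
  - by rewrite nnegrE powR_ge0.
  - by rewrite nnegrE sumr_ge0// => j _; exact: powR_ge0.
  rewrite (bigD1 i)//= lerDl sumr_ge0// => j _; exact: powR_ge0.
by move=> _; apply: (le_bigmax _ (fun i => `|x 0 i|)).
Qed.

Lemma lpnorm_eq0 p x : (1 <= p)%E -> lpnorm p x <= 0 -> x = 0.
Proof.
move=> p1 x0; apply/rowP => i; rewrite mxE; apply/eqP; rewrite -normr_le0.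
exact: le_trans (coord_le_lpnorm _ _ p1) x0.
Qed.

Lemma lpnormZ p (c : R) x : (1 <= p)%E -> lpnorm p (c *: x) = `|c| * lpnorm p x.
Proof.
case: p => [r| |]//=; last first.
  move=> _; rewrite (@big_morph _ _ (fun z => `|c| * z) 0 Num.max 0 Num.max).
  - by apply: eq_bigr => i _; rewrite mxE normrM.
  - by move=> a b; rewrite maxr_pMr.
  - by rewrite mulr0.
rewrite lee_fin => r1; have r0 : 0 < r by lra.
rewrite -[in RHS](powRKV r0 (normr_ge0 c)) -powRM ?powR_ge0//; last first.
  by rewrite sumr_ge0// => i _; exact: powR_ge0.
by rewrite mulr_sumr; under eq_bigr do rewrite mxE normrM powRM//.
Qed.

Lemma lpnorm_le_mxnorm p x : (1 <= p)%E -> lpnorm p x <= d%:R * `|x|.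
Proof.
have xi i : `|x 0 i| <= `|x|.
  by rewrite [leRHS]mx_normrE; apply: (le_bigmax _ (fun ij => `|x ij.1 ij.2|) (0, i)).
case: p => [r| |]//=; last first.
  move=> _; apply/bigmax_leP; split=> [|i _]; first by rewrite mulr_ge0.
  by rewrite (le_trans (xi i))// ler_peMl// ler1n; case: i => j; exact: leq_trans.
rewrite lee_fin => r1; have r0 : 0 < r by lra.
apply: lpnorm_le; rewrite ?mulr_ge0//.
apply: (@le_trans _ _ (\sum_(i < d) `|x| `^ r)).
  by apply: ler_sum => i _; apply: ge0_ler_powR; rewrite ?nnegrE// ltW.
rewrite sumr_const card_ord -[leLHS]mulr_natl powRM// ler_wpM2r ?powR_ge0//.
have [d1|] := leP 1%:R (d%:R : R); first exact: le1r_powR.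
by rewrite ltr_nat ltnS leqn0 => /eqP->; exact: powR_ge0.
Qed.

(** Divided by the norm, all coordinates are at most 1 in absolute value, so
    raising the exponent from [r] to [n] decreases the sum of their powers. *)
Lemma sum_expr_le_lpnorm r n x : 1 <= r -> r <= n%:R ->
  \sum_i `|x 0 i| ^+ n <= lpnorm r%:E x ^+ n.
Proof.
move=> r1 rn; have r0 : 0 < r by lra.
have p1 : (1 <= r%:E)%E by rewrite lee_fin.
have N0 := lpnorm_ge0 r%:E x; have [N_eq0|N_neq0] := eqVneq (lpnorm r%:E x) 0.
  have -> : x = 0 by apply: (lpnorm_eq0 p1); rewrite N_eq0.
  rewrite big1 ?exprn_ge0 ?lpnorm_ge0// => i _; rewrite mxE normr0 expr0n.
  by case: n rn => [|//] rn; exfalso; lra.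
have {}N0 : 0 < lpnorm r%:E x by rewrite lt0r N_neq0.
set N := lpnorm r%:E x in N0 *.
suff : \sum_i (`|x 0 i| / N) ^+ n <= 1.
  under eq_bigr do rewrite exprMn exprVn.
  by rewrite -mulr_suml ler_pdivrMr ?exprn_gt0// mul1r.
have <- : \sum_i (`|x 0 i| / N) `^ r = 1.
  under eq_bigr do rewrite powRM ?invr_ge0 ?(ltW N0)//.
  rewrite -mulr_suml -lpnorm_powR// -powRM ?invr_ge0 ?(ltW N0)//.
  by rewrite divff ?powR1// gt_eqF.
apply: ler_sum => i _; rewrite -powR_mulrn ?divr_ge0 ?(ltW N0)//.
have [-> |x0] := eqVneq (x 0 i) 0.
  by rewrite normr0 mul0r !powR0 ?gt_eqF//; lra.
apply: ger_powR => //; rewrite divr_gt0 ?normr_gt0//=.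
by rewrite ler_pdivrMr// mul1r coord_le_lpnorm.
Qed.

Lemma dual_lpnorm1 g : dual_lpnorm 1%E g = lpnorm +oo g.
Proof. by rewrite /dual_lpnorm hoelder_conjugate1. Qed.

Lemma dual_lpnormy g : dual_lpnorm +oo g = lpnorm 1%E g.
Proof. by rewrite /dual_lpnorm hoelder_conjugatey. Qed.

Lemma dual_lpnormr r g : 1 < r ->
  dual_lpnorm r%:E g = lpnorm (r / (r - 1))%:E g.
Proof.
move=> r1; rewrite /dual_lpnorm /hoelder_conjugate/= eqe gt_eqF; last by lra.
by rewrite inver subr_eq0 gt_eqF.
Qed.

Lemma dual_lpnorm_ge0 p g : 0 <= dual_lpnorm p g.
Proof. exact: lpnorm_ge0. Qed.

Lemma hoelder_sum_max g h :
  dot g h <= lpnorm +oo g * lpnorm 1%E h.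
Proof.
rewrite -[lpnorm 1%E h](powRr1 (lpnorm_ge0 _ _)) lpnorm_powR// mulr_sumr.
apply: ler_sum => i _; rewrite powRr1// (le_trans (ler_norm _))// normrM.
by rewrite ler_wpM2r// (coord_le_lpnorm (p := +oo))// leey.
Qed.

(** Young's inequality for the coordinates divided by the two norms. *)
Lemma hoelder_dot p g h : (1 <= p)%E -> dot g h <= dual_lpnorm p g * lpnorm p h.
Proof.
case: p => [r| |]//; last first.
  by move=> _; rewrite dual_lpnormy mulrC dotC hoelder_sum_max.
rewrite lee_fin le_eqVlt => /orP[/eqP <-|r1].
  by rewrite dual_lpnorm1 hoelder_sum_max.
rewrite dual_lpnormr//; set q := r / (r - 1).
have r0 : 0 < r by lra.
have q1 : 1 <= q by rewrite /q ler_pdivlMr; lra.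
have q0 : 0 < q by lra.
have qr : q^-1 + r^-1 = 1 by rewrite /q invf_div; field; rewrite gt_eqF.
have [A0 B0] := (lpnorm_ge0 q%:E g, lpnorm_ge0 r%:E h).
have SA := lpnorm_powR g q0; have SB := lpnorm_powR h r0.
have [gz|gnz] := eqVneq (lpnorm q%:E g) 0.
  have -> : g = 0 by apply: (@lpnorm_eq0 q%:E); rewrite ?lee_fin// gz.
  by rewrite dot0l; apply: mulr_ge0; apply: lpnorm_ge0.
have [hz|hnz] := eqVneq (lpnorm r%:E h) 0.
  have -> : h = 0 by apply: (@lpnorm_eq0 r%:E); rewrite ?lee_fin ?(ltW r1)// hz.
  by rewrite dotC dot0l; apply: mulr_ge0; apply: lpnorm_ge0.
move: (lpnorm _ g) (lpnorm _ h) A0 B0 SA SB gnz hnz => A B A0 B0 SA SB gnz hnz.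
have {gnz}A1 : 0 < A by rewrite lt0r gnz.
have {hnz}B1 : 0 < B by rewrite lt0r hnz.
rewrite -[leRHS]mulr1 -ler_pdivrMl ?mulr_gt0// mulr_sumr -qr.
have <- : \sum_i ((`|g 0 i| / A) `^ q / q + (`|h 0 i| / B) `^ r / r) = q^-1 + r^-1.
  rewrite big_split/= -!mulr_suml; congr (_ + _).
    under eq_bigr do rewrite powRM ?invr_ge0//.
    by rewrite -mulr_suml -SA -powRM ?invr_ge0// divff ?powR1 ?mul1r// gt_eqF.
  under eq_bigr do rewrite powRM ?invr_ge0//.
  by rewrite -mulr_suml -SB -powRM ?invr_ge0// divff ?powR1 ?mul1r// gt_eqF.
apply: ler_sum => i _.
have := @conjugate_powR R (`|g 0 i| / A) (`|h 0 i| / B) q r.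
move=> /(_ _ _ q0 r0 qr) young; apply: le_trans (young _ _); rewrite ?divr_ge0//.
rewrite mulrACA -invfM -normrM mulrC ler_wpM2r ?ler_norm//.
by rewrite invr_ge0 mulr_ge0.
Qed.

(** The bound is tested on the vector at which Hoelder's inequality for [g] is an
    equality. *)
Lemma dual_lpnorm_le p g (M : R) : (1 <= p)%E -> 0 <= M ->
  (forall h, dot g h <= M * lpnorm p h) -> dual_lpnorm p g <= M.
Proof.
move=> p1 M0; case: p p1 => [r| |]//; last first.
  move=> _ /(_ (\row_i Num.sg (g 0 i))) hM.
  rewrite dual_lpnormy -[leLHS](powRr1 (lpnorm_ge0 _ _)) lpnorm_powR//.
  have -> : \sum_i `|g 0 i| `^ 1 = dot g (\row_i Num.sg (g 0 i)).
    by apply: eq_bigr => i _; rewrite powRr1// mxE mulrC -normrEsg.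
  apply: (le_trans hM); rewrite ler_piMr//=.
  apply/bigmax_leP; split=> // i _; rewrite mxE normr_sg.
  by case: eqVneq.
rewrite lee_fin le_eqVlt => /orP[/eqP <-|r1] hM.
  rewrite dual_lpnorm1; apply/bigmax_leP; split=> // i _.
  have := hM (Num.sg (g 0 i) *: delta_mx 0 i).
  rewrite dotZr dot_delta -normrEsg => /le_trans; apply.
  rewrite ler_piMr// lpnorm_le//.
  rewrite powR1 (bigD1 i)//= big1 => [|j /negPf ji]; rewrite !mxE powRr1//.
    by rewrite !eqxx mulr1 addr0 normr_sg; case: eqVneq.
  by rewrite ji andbF mulr0 normr0.
rewrite dual_lpnormr//; set q := r / (r - 1).
have r0 : 0 < r by lra.
have q0 : 0 < q by rewrite /q divr_gt0//; lra.
set S := \sum_i `|g 0 i| `^ q.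
have S0 : 0 <= S by rewrite sumr_ge0// => i _; exact: powR_ge0.
have := hM (\row_i (Num.sg (g 0 i) * `|g 0 i| `^ (q - 1))).
have -> : dot g (\row_i (Num.sg (g 0 i) * `|g 0 i| `^ (q - 1))) = S.
  apply: eq_bigr => i _; rewrite mxE mulrCA mulrA -normrEsg.
  by rewrite mulr_powRB1.
have -> : lpnorm r%:E (\row_i (Num.sg (g 0 i) * `|g 0 i| `^ (q - 1))) = S `^ r^-1.
  rewrite /=; congr (_ `^ _); apply: eq_bigr => i _; rewrite mxE.
  have [->|g0] := eqVneq (g 0 i) 0.
    by rewrite sgr0 mul0r normr0 !powR0 ?gt_eqF.
  rewrite normrM normr_sg g0 mul1r ger0_norm ?powR_ge0// -powRrM.
  by congr (_ `^ _); rewrite /q; field; lra.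
move=> SM; rewrite /= -/S.
have [->|Sn0] := eqVneq S 0; first by rewrite powR0// invr_eq0 gt_eqF.
have {}S0 : 0 < S by rewrite lt0r Sn0.
rewrite -(ler_pM2r (powR_gt0 r^-1 S0)); apply: le_trans SM.
rewrite -powRD ?Sn0 ?implybT//.
by rewrite (_ : q^-1 + r^-1 = 1) ?powRr1 ?(ltW S0)// /q invf_div; field; rewrite gt_eqF.
Qed.

End LpNorm.

(** * The hard functions *)

Section HardFunction.
Variables (R : realType) (d n k : nat) (delta s : R).
Hypotheses (delta_gt0 : 0 < delta) (s_gt0 : 0 < s).
Implicit Types (l : seq 'rV[R]_d) (x y h v w : 'rV[R]_d) (p : \bar R).

(** At a point [x], the values whose smoothed maximum is the hard function. The
    constant is the floor that makes the function bounded below; the index [n] always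
    carries it, and so do the indices of the vectors not chosen yet. Consecutive
    values are offset by [2 * delta], twice the range of the smoothing, so that a piece
    stays inactive on a whole neighborhood. *)
Definition pieces l x (j : 'I_n.+1) : R :=
  if (j < size l)%N then dot l`_j x - 2 * delta * j%:R else - (2 * delta * n%:R).

Definition hard l x : R := s * smax k delta (pieces l x).

Definition hard_grad l x : 'rV[R]_d :=
  s *: \sum_j weight k delta (pieces l x) j *: l`_j.

Lemma piecesB l x y j : pieces l x j - pieces l y j = dot l`_j (x - y).
Proof.
rewrite /pieces; case: ltnP => jl; first by rewrite linearB/=; ring.
by rewrite nth_default// dot0l subrr.
Qed.

Lemma dot_hard_grad l x h :
  dot (hard_grad l x) h = s * \sum_j weight k delta (pieces l x) j * dot l`_j h.
Proof.
by rewrite dotZl dot_suml; congr (_ * _); apply: eq_bigr => j _; rewrite dotZl.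
Qed.

Lemma hard_subgradient l x y :
  hard l x + dot (hard_grad l x) (y - x) <= hard l y.
Proof.
rewrite dot_hard_grad -mulrDr ler_pM2l//.
under eq_bigr do rewrite -piecesB.
exact: (smax_subgradient k delta_gt0 ord0).
Qed.

Section Smoothness.
Variables (p : \bar R) (kappa L K0 : R) (l : seq 'rV[R]_d).
Hypotheses (p1 : (1 <= p)%E) (hkappa : 1 < kappa <= 2) (K0_gt0 : 0 < K0).
Hypothesis embedding : forall h,
  \sum_(j < n.+1) dot l`_j h ^+ (k.+1).*2 <= (K0 * lpnorm p h) ^+ (k.+1).*2.
Hypothesis L_ge :
  s * (2 * K0 * (3 * k.+1%:R * K0 / delta) `^ (kappa - 1)) <= L.

Let L_ge0 : 0 <= L.
Proof.
by apply: le_trans L_ge; rewrite !mulr_ge0 ?powR_ge0// ltW.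
Qed.

(** [weight_hoelder] transported to R^d: [embedding] says that the map sending [h]
    to its pairings with the vectors of [l] has norm at most [K0] from l_p to
    l_(2k+2), and this norm enters once for [h] and once for [x - y]. *)
Lemma hard_grad_hoelder_dot x y h :
  dot (hard_grad l x - hard_grad l y) h <=
  L * lpnorm p (x - y) `^ (kappa - 1) * lpnorm p h.
Proof.
have RHS0 : 0 <= L * lpnorm p (x - y) `^ (kappa - 1) * lpnorm p h.
  by rewrite !mulr_ge0 ?powR_ge0 ?lpnorm_ge0.
have [h0|hpos] := leP (lpnorm p h) 0.
  by rewrite (lpnorm_eq0 p1 h0) linear0 -(lpnorm_eq0 p1 h0).
have [xy0|xypos] := leP (lpnorm p (x - y)) 0.
  have /eqP := lpnorm_eq0 p1 xy0; rewrite subr_eq0 => /eqP {1}->.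
  by rewrite subrr dot0l.
have T0 : 0 < K0 * lpnorm p h by rewrite mulr_gt0.
have T'0 : 0 < K0 * lpnorm p (x - y) by rewrite mulr_gt0.
have uvT' : \sum_i (pieces l x i - pieces l y i) ^+ (k.+1).*2 <=
    (K0 * lpnorm p (x - y)) ^+ (k.+1).*2.
  by under eq_bigr do rewrite piecesB; exact: embedding.
have := weight_hoelder delta_gt0 ord0 T0 T'0 hkappa (embedding h) uvT'.
rewrite dotBl !dot_hard_grad -mulrBr -sumrB.
under eq_bigr do rewrite mulrBl; move=> /(le_trans (ler_norm _)).
rewrite -(ler_pM2l s_gt0) => /le_trans; apply.
have -> : 3 * k.+1%:R * (K0 * lpnorm p (x - y)) / delta =
  (3 * k.+1%:R * K0 / delta) * lpnorm p (x - y) by ring.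
rewrite powRM ?lpnorm_ge0 ?divr_ge0 ?mulr_ge0 ?(ltW delta_gt0) ?(ltW K0_gt0)//.
apply: le_trans (_ : s * (2 * K0 * (3 * k.+1%:R * K0 / delta) `^ (kappa - 1)) *
  (lpnorm p (x - y) `^ (kappa - 1) * lpnorm p h) <= _).
  by rewrite le_eqVlt; apply/orP; left; apply/eqP; ring.
by rewrite -[leRHS]mulrA ler_wpM2r// mulr_ge0 ?powR_ge0 ?lpnorm_ge0.
Qed.

Lemma hard_differentiable x :
  differentiable (hard l) x /\ grad (hard l) x = hard_grad l x.
Proof.
case/andP: hkappa => k1 _.
apply: (@grad_of_subgradient _ _ _ _ (L * d%:R `^ kappa) kappa) => //.
- by rewrite mulr_ge0 ?powR_ge0.
- exact: hard_subgradient.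
move=> z y; apply: (le_trans (hard_grad_hoelder_dot _ _ _)).
rewrite -!mulrA ler_wpM2l// -powRM//.
rewrite mulrC mulr_powRB1 ?lpnorm_ge0//; last by lra.
apply: ge0_ler_powR; rewrite ?nnegrE ?lpnorm_ge0 ?mulr_ge0//; first lra.
exact: lpnorm_le_mxnorm.
Qed.

Lemma hard_weakly_smooth : weakly_smooth_convex p kappa L (hard l).
Proof.
split.
- exact: convex_of_subgradient (hard_subgradient l).
- by move=> x; have [] := hard_differentiable x.
move=> x y; have [_ ->] := hard_differentiable x; have [_ ->] := hard_differentiable y.
apply: dual_lpnorm_le => //; first by rewrite mulr_ge0 ?powR_ge0.
exact: hard_grad_hoelder_dot.
Qed.

End Smoothness.

(** Appending a vector [v] only changes the piece number [size l], which near [x]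
    stays at least [delta] below the piece number [j]. *)
Lemma hard_rcons_near l v x j : (size l < n)%N -> (j < size l)%N ->
  0 <= dot l`_j x -> dot v x <= dot l`_j x ->
  \forall y \near x, hard (rcons l v) y = hard l y.
Proof.
move=> ln jl lx0 vx.
have jn : (j < n.+1)%N by rewrite ltnS (leq_trans (ltnW jl))// ltnW.
have near_ge (a : 'rV[R]_d) : 0 <= dot a x -> \forall y \near x, - delta < dot a y.
  move=> a0; have c := @continuous_dot _ _ a x.
  by apply: (cvgr_gt _ c); rewrite (lt_le_trans _ a0)// oppr_lt0.
have /near_ge near1 : 0 <= dot (l`_j - v) x by rewrite dotBl subr_ge0.
have {}near_ge := near_ge _ lx0.
near=> y.
have hb : - delta < dot l`_j y by near: y.
have hc : - delta < dot (l`_j - v) y by near: y.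
rewrite dotBl in hc.
congr (s * _); apply: (smax_eq delta_gt0 ord0) => i.
have jE l' : (j < size l')%N ->
    pieces l' y (Ordinal jn) = dot l'`_j y - 2 * delta * j%:R.
  by move=> jl'; rewrite /pieces /= jl'.
have jl1 : (j < size (rcons l v))%N by rewrite size_rcons ltnS ltnW.
have [il|il|il] := ltngtP i (size l).
- by left; rewrite /pieces size_rcons nth_rcons il ltnS (ltnW il).
- by left; rewrite /pieces size_rcons ltnS leqNgt il ltnNge (ltnW il).
have jnR : (j%:R + 1 <= n%:R :> R) by rewrite natr1 ler_nat (leq_trans jl)// ltnW.
have jlR : (j%:R + 1 <= (size l)%:R :> R) by rewrite natr1 ler_nat.
right; split; apply: (@weight_eq0 _ _ _ _ delta_gt0 _ (Ordinal jn)).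
  rewrite (jE _ jl1) /pieces size_rcons il ltnSn !nth_rcons ltnn eqxx jl.
  by have := ler_wpM2l (ltW delta_gt0) jlR; lra.
by rewrite (jE _ jl) /pieces il ltnn; have := ler_wpM2l (ltW delta_gt0) jnR; lra.
Unshelve. all: by end_near. Qed.

Section FullList.
Variables (p : \bar R) (l : seq 'rV[R]_d) (w : 'rV[R]_d) (mu : R).
Hypotheses (size_l : size l = n) (p1 : (1 <= p)%E) (w1 : lpnorm p w <= 1).
Hypothesis lw : forall j, (j < n)%N -> dot l`_j w = mu.

(** Piece [j] keeps the floor inactive at [x], so the gradient is [s] times a convex
    combination of the vectors of [l], all of which have the same pairing with [w]. *)
Lemma dual_hard_grad_ge x j : (j < n)%N -> 0 <= dot l`_j x ->
  s * mu <= dual_lpnorm p (hard_grad l x).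
Proof.
move=> jn lx0.
have -> : s * mu = dot (hard_grad l x) w.
  rewrite dot_hard_grad; congr (_ * _).
  rewrite -[LHS]mul1r -(sum_weight k delta_gt0 ord0 (pieces l x)) mulr_suml.
  apply: eq_bigr => i _; have [iin|iin] := ltnP i n; first by rewrite lw.
  rewrite (@weight_eq0 _ _ _ _ delta_gt0 _ (Ordinal (leqW jn : (j < n.+1)%N))) ?mul0r//.
  rewrite /pieces /= size_l jn ltnNge iin/=.
  have : (j%:R + 1 <= n%:R :> R) by rewrite natr1 ler_nat.
  by move: delta_gt0; nra.
apply: (le_trans (hoelder_dot _ _ p1)); rewrite ler_piMr// dual_lpnorm_ge0 //.
Qed.

(** At [- Rad *: w] every piece is at least [delta] below the floor, so the gradient
    vanishes there. *)
Lemma hard_min_attained Rad : 0 < Rad -> (n.*2.+1)%:R * delta <= Rad * mu ->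
  min_attained_in_ball p Rad (hard l).
Proof.
move=> Rad0 gap; exists (- Rad *: w).
  by rewrite lpnormZ// normrN gtr0_norm// ler_piMr// ltW.
move=> y; have := hard_subgradient l (- Rad *: w) y; rewrite dot_hard_grad.
rewrite big1 ?mulr0 ?addr0// => i _.
have [iin|iin] := ltnP i n; last by rewrite nth_default ?size_l// dot0l mulr0.
rewrite (@weight_eq0 _ _ _ _ delta_gt0 _ ord_max) ?mul0r//.
rewrite /pieces /= size_l iin ltnn dotZr lw//.
have i0 : 0 <= (i%:R : R) by [].
move: gap delta_gt0; rewrite -addn1 -muln2 natrD natrM; nra.
Qed.

End FullList.
End HardFunction.

(** * The resisting oracle *)

Section ResistingOracle.
Variables (R : realType) (d n k : nat) (delta c : R) (V : Type).
Variables (F : set ('rV[R]_d -> R)) (O : ('rV[R]_d -> R) -> 'rV[R]_d -> V).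
Variables (A : @algorithm R d V) (z : 'I_n -> 'rV[R]_d).
Hypothesis delta_gt0 : 0 < delta.
Hypothesis localO : local_oracle F O.

(** A choice is recorded as an index and a sign rather than as a signed vector, so
    that unused indices can be told and the signs read off again. *)
Definition signed (s : seq ('I_n * bool)) : seq 'rV[R]_d :=
  [seq (-1) ^+ nat_of_bool ib.2 *: z ib.1 | ib <- s].

Let f s := hard n k delta c (signed s).
Hypothesis Ff : forall s, uniq (unzip1 s) -> F (f s).

Lemma transcript_eq f1 f2 t : F f1 -> F f2 ->
  (forall j, (j < t)%N -> \forall y \near query O f1 A j, f2 y = f1 y) ->
  forall j, (j <= t)%N -> transcript O f2 A j = transcript O f1 A j.
Proof.
move=> F1 F2 near12; elim=> [//|j IHj] jt.
have {}IHj := IHj (ltnW jt); rewrite /= IHj.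
by rewrite (localO F2 F1 (near12 j jt)).
Qed.

(** The adversary: query number [j] is answered by the unused vector with the largest
    absolute pairing with the query point, with the sign that makes this pairing
    nonnegative. By this choice the vectors used later stay below it near that
    point, whatever their signs, so by locality enlarging the list does not change
    the answers already given. *)
Lemma resisting_signs t : (t <= n)%N -> exists s : seq ('I_n * bool),
  [/\ size s = t, uniq (unzip1 s) &
    forall j, (j < t)%N ->
      0 <= dot (signed s)`_j (query O (f s) A j) /\
      forall i, i \notin take j (unzip1 s) ->
        `|dot (z i) (query O (f s) A j)| <=
        dot (signed s)`_j (query O (f s) A j)].
Proof.
elim: t => [_|t IHt tn]; first by exists [::]; split.
have [s [size_s uniq_s sP]] := IHt (ltnW tn).
pose x := query O (f s) A t.
have [i0 i0s] : exists i0, i0 \notin unzip1 s.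
  apply/existsP; rewrite -negb_forall; apply/negP => /forallP all_s.
  have := uniq_leq_size (enum_uniq 'I_n) (fun i _ => all_s i).
  by rewrite size_enum_ord size_map size_s leqNgt tn.
have [i is_ imax] : exists2 i, i \notin unzip1 s &
    forall i', i' \notin unzip1 s -> `|dot (z i') x| <= `|dot (z i) x|.
  case: (@arg_maxP _ _ _ i0 (fun i => i \notin unzip1 s) (fun i => `|dot (z i) x|) i0s).
  by move=> i is_ imax; exists i.
pose b := dot (z i) x < 0.
have vx : dot ((-1) ^+ (b : nat) *: z i) x = `|dot (z i) x|.
  rewrite dotZl /b; case: ltP => h; first by rewrite expr1 mulN1r ltr0_norm.
  by rewrite expr0 mul1r ger0_norm.
pose s' := rcons s (i, b).
have uniq_s' : uniq (unzip1 s') by rewrite /s' /unzip1 map_rcons rcons_uniq is_.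
have signed_s' : signed s' = rcons (signed s) ((-1) ^+ (b : nat) *: z i).
  by rewrite /signed map_rcons.
have size_l : size (signed s) = t by rewrite size_map.
have same j : (j <= t)%N -> query O (f s') A j = query O (f s) A j.
  move=> jt; rewrite /query; congr (A _).
  apply: transcript_eq jt; [exact: Ff|exact: Ff|] => {}j jt.
  have [ge0 jmax] := sP j jt.
  rewrite /f signed_s'.
  apply: (@hard_rcons_near _ _ _ _ _ _ delta_gt0 _ _ _ j) => //; rewrite ?size_l//.
  apply: le_trans (jmax i _); last by apply: contra is_ => /mem_take.
  by rewrite dotZl (le_trans (ler_norm _))// normrM normrX normrN1 expr1n mul1r.
exists s'; split=> //; first by rewrite size_rcons size_s.
move=> j; rewrite ltnS leq_eqVlt => /orP[/eqP ->|jt].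
  rewrite same// -/x signed_s' nth_rcons size_l ltnn eqxx vx; split=> // i'.
  by rewrite /s' /unzip1 map_rcons -cats1 take_size_cat ?size_map// => /imax.
have [ge0 jmax] := sP j jt; rewrite (same _ (ltnW jt)) signed_s' nth_rcons size_l jt.
split=> // i'; rewrite /s' /unzip1 map_rcons -cats1 takel_cat; first exact: jmax.
by rewrite size_map size_s ltnW.
Qed.

End ResistingOracle.

(** * From families of vectors to complexity bounds *)

Section LowerBound.
Variables (R : realType) (d n : nat) (V : Type).
Variables (z : 'I_n -> 'rV[R]_d).

Lemma sum_signed_le k (s : seq ('I_n * bool)) h : uniq (unzip1 s) ->
  \sum_(j < n.+1) dot (signed z s)`_j h ^+ (k.+1).*2 <=
  \sum_i dot (z i) h ^+ (k.+1).*2.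
Proof.
move=> us; set g := fun v : 'rV[R]_d => dot v h ^+ (k.+1).*2.
have g0 : g 0 = 0 by rewrite /g dot0l expr0n.
have size_s : (size (signed z s) <= n)%N.
  rewrite size_map -(size_map fst) -[X in (_ <= X)%N](size_enum_ord n).
  by apply: uniq_leq_size => // i _; rewrite mem_enum.
have -> : \sum_(j < n.+1) g (signed z s)`_j = \sum_(v <- signed z s) g v.
  rewrite [RHS](big_nth 0) big_mkord.
  transitivity (\sum_(j < n.+1 | (j < size (signed z s))%N) g (signed z s)`_j).
    rewrite [RHS]big_mkcond/=; apply: eq_bigr => j _.
    by case: ltnP => // jl; rewrite nth_default.
  exact/esym/(@big_ord_widen _ _ _ _ n.+1 (fun j => g (signed z s)`_j))/leqW.
rewrite big_map.
have -> : \sum_(ib <- s) g ((-1) ^+ nat_of_bool ib.2 *: z ib.1) =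
    \sum_(i <- unzip1 s) g (z i).
  rewrite big_map; apply: eq_bigr => -[i b] _ /=.
  by rewrite /g dotZl exprMn -mul2n [X in X * _]exprM sqrr_sign expr1n mul1r.
rewrite big_uniq//= [leRHS](bigID (mem (unzip1 s)))/= lerDl sumr_ge0// => i _.
by rewrite -mul2n exprM exprn_ge0// sqr_ge0.
Qed.

(** The sign attached to position [j] is recovered from the index of the vector
    alone. This turns the list of signs into the function of the index that the
    dual witness has to match. *)
Lemma signed_nth (s : seq ('I_n * bool)) j : uniq (unzip1 s) -> size s = n ->
  (j < n)%N -> exists i,
  (signed z s)`_j =
    (-1) ^+ nat_of_bool (nth (i, false) s (index i (unzip1 s))).2 *: z i.
Proof.
move=> us sn jn; pose i0 := Ordinal jn; exists (nth (i0, false) s j).1.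
have js : (j < size s)%N by rewrite sn.
rewrite (nth_map (i0, false))//.
have -> : index (nth (i0, false) s j).1 (unzip1 s) = j.
  by rewrite -(nth_map _ i0 fst)// index_uniq// size_map.
by rewrite (set_nth_default (i0, false) (_, _) js).
Qed.

(** The smoothing range is [delta = Rad * mu / (2 n + 1)], the largest
    that [hard_min_attained] allows, and the scale of the function is the largest that
    [hard_weakly_smooth] allows; the last hypothesis says that the resulting
    gradients, of dual norm at least scale times [mu], exceed [eps]. *)
Theorem complexity_ge_of_family (p : \bar R) (kappa L Rad eps mu K0 : R) (k : nat)
    (O : ('rV[R]_d -> R) -> 'rV[R]_d -> V) :
  (1 <= p)%E -> 1 < kappa <= 2 -> 0 < L -> 0 < Rad -> 0 < mu -> 0 < K0 ->
  local_oracle (weakly_smooth_convex p kappa L) O ->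
  (forall h, \sum_i dot (z i) h ^+ (k.+1).*2 <= (K0 * lpnorm p h) ^+ (k.+1).*2) ->
  (forall sg : 'I_n -> bool, exists w, lpnorm p w <= 1 /\
    forall i, dot (z i) w = (-1) ^+ nat_of_bool (sg i) * mu) ->
  eps < mu * (L / (2 * K0 *
    (3 * k.+1%:R * K0 * (n.*2.+1)%:R / (Rad * mu)) `^ (kappa - 1))) ->
  (n%:R%:E <= oracle_complexity p
    (weakly_smooth_convex p kappa L `&` min_attained_in_ball p Rad) O eps)%E.
Proof.
move=> p1 hk L0 Rad0 mu0 K00 locO emb dual_w eps_lt.
set delta := Rad * mu / (n.*2.+1)%:R.
set c := L / (2 * K0 * (3 * k.+1%:R * K0 * (n.*2.+1)%:R / (Rad * mu)) `^ (kappa - 1)).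
have delta0 : 0 < delta by rewrite divr_gt0 ?mulr_gt0.
have deltaE : 3 * k.+1%:R * K0 / delta = 3 * k.+1%:R * K0 * (n.*2.+1)%:R / (Rad * mu).
  by rewrite /delta invf_div mulrA.
have den0 : 0 < 2 * K0 * (3 * k.+1%:R * K0 / delta) `^ (kappa - 1).
  by rewrite !mulr_gt0// powR_gt0// divr_gt0// !mulr_gt0.
have c0 : 0 < c by rewrite /c -deltaE divr_gt0.
have cL : c * (2 * K0 * (3 * k.+1%:R * K0 / delta) `^ (kappa - 1)) <= L.
  by rewrite /c -deltaE divfK// gt_eqF.
have embs s h : uniq (unzip1 s) ->
    \sum_(j < n.+1) dot (signed z s)`_j h ^+ (k.+1).*2 <=
    (K0 * lpnorm p h) ^+ (k.+1).*2.
  by move=> us; exact: le_trans (sum_signed_le k h us) (emb h).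
have Ff s : uniq (unzip1 s) ->
    weakly_smooth_convex p kappa L (hard n k delta c (signed z s)).
  by move=> us; apply: (hard_weakly_smooth delta0 c0 p1 hk K00 _ cL) => h; exact: embs.
apply: le_ereal_inf_tmp => _ [A _ <-].
have [s [size_s uniq_s sP]] := resisting_signs A delta0 locO Ff (leqnn n).
set f := hard n k delta c (signed z s) in sP.
have size_l : size (signed z s) = n by rewrite size_map.
have [w [w1 zw]] := dual_w (fun i => (nth (i, false) s (index i (unzip1 s))).2).
have lw j : (j < n)%N -> dot (signed z s)`_j w = mu.
  move=> /(signed_nth uniq_s size_s)[i ->].
  by rewrite dotZl zw mulrA -signr_addb addbb mul1r.
have fP : (weakly_smooth_convex p kappa L `&` min_attained_in_ball p Rad) f.
  split; first exact: Ff.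
  apply: (hard_min_attained k delta0 c0 size_l p1 w1 lw Rad0).
  by rewrite /delta mulrC divfK.
have fsup : (running_time p O f A eps <=
    ereal_sup [set running_time p O g A eps | g in
      weakly_smooth_convex p kappa L `&` min_attained_in_ball p Rad])%E.
  by apply: ereal_sup_ubound; exists f.
apply: le_trans fsup; apply: le_ereal_inf_tmp => _ [j small_j <-].
rewrite lee_fin ler_nat leqNgt; apply/negP => jn.
have [ge0 _] := sP j jn.
have [_ gradE] := hard_differentiable delta0 c0 p1 hk K00
  (fun h => embs s h uniq_s) cL (query O f A j).
move: small_j; rewrite /= gradE leNgt => /negP; apply.
apply: lt_le_trans (dual_hard_grad_ge k c delta0 size_l p1 w1 lw jn ge0).
by rewrite mulrC.
Qed.

End LowerBound.

(** * Two families of vectors *)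

Section Embedding.
Variables (R : realType) (d n k : nat) (z : 'I_n -> 'rV[R]_d) (p : \bar R).

(** On [n] coordinates, the l_(2k+2) norm is at most [n ^ (1 / (2 k + 2))] times the
    maximum norm. This factor is bounded as soon as [k] reaches the order of
    [ln n]. *)
Lemma sum_dot_le (K0 : R) h : 0 <= K0 -> n%:R <= K0 ^+ (k.+1).*2 ->
  (forall i, `|dot (z i) h| <= lpnorm p h) ->
  \sum_i dot (z i) h ^+ (k.+1).*2 <= (K0 * lpnorm p h) ^+ (k.+1).*2.
Proof.
move=> K00 nK zh; have N0 := lpnorm_ge0 p h.
apply: (@le_trans _ _ (\sum_(i < n) lpnorm p h ^+ (k.+1).*2)).
  apply: ler_sum => i _; rewrite -mul2n !exprM -(real_normK (num_real (dot _ _))).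
  by rewrite -!exprM lerXn2r.
by rewrite sumr_const card_ord -[leLHS]mulr_natl exprMn ler_wpM2r// exprn_ge0.
Qed.

End Embedding.

Section CoordinateFamily.
Variables (R : realType) (d n : nat) (nd : (n <= d)%N).

Definition coord_family (i : 'I_n) : 'rV[R]_d := delta_mx 0 (widen_ord nd i).

Lemma dot_coord i h : dot (coord_family i) h = h 0 (widen_ord nd i).
Proof. by rewrite dotC dot_delta. Qed.

Lemma sum_coord_le k (q : R) h : 1 <= q -> q <= (k.+1).*2%:R ->
  \sum_i dot (coord_family i) h ^+ (k.+1).*2 <= (1 * lpnorm q%:E h) ^+ (k.+1).*2.
Proof.
move=> q1 qk; rewrite mul1r; apply: le_trans (sum_expr_le_lpnorm h q1 qk).
have -> : \sum_i dot (coord_family i) h ^+ k.+1.*2 =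
    \sum_(j < d | (j < n)%N) `|h 0 j| ^+ k.+1.*2.
  rewrite big_ord_narrow; apply: eq_bigr => i _; rewrite dot_coord -mul2n !exprM.
  by rewrite real_normK// num_real.
rewrite [leRHS](bigID (fun j : 'I_d => (j < n)%N))/= lerDl sumr_ge0// => j _.
Qed.

Definition coord_dual (mu : R) (sg : 'I_n -> bool) : 'rV[R]_d :=
  \row_j oapp (fun i => (-1) ^+ nat_of_bool (sg i) * mu) 0 (insub (val j)).

Lemma dot_coord_dual mu sg i :
  dot (coord_family i) (coord_dual mu sg) = (-1) ^+ nat_of_bool (sg i) * mu.
Proof. by rewrite dot_coord mxE /= valK. Qed.

Lemma normr_coord_dual mu sg j : 0 <= mu ->
  `|coord_dual mu sg 0 j| = if (j < n)%N then mu else 0.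
Proof.
move=> mu0; rewrite mxE; case: insubP => [i _ <-|/negPf->] /=; last by rewrite normr0.
by rewrite ltn_ord normrM normrX normrN1 expr1n mul1r ger0_norm.
Qed.

Lemma lpnorm_coord_dual (q : R) sg : 0 < q -> (0 < n)%N ->
  lpnorm q%:E (coord_dual (n%:R `^ - q^-1) sg) <= 1.
Proof.
move=> q0 n0; have mu0 : 0 <= n%:R `^ - q^-1 :> R by exact: powR_ge0.
apply: lpnorm_le => //; under eq_bigr do rewrite normr_coord_dual//.
rewrite powR1 (bigID (fun j : 'I_d => (j < n)%N))/=.
rewrite [X in _ + X]big1 ?addr0 => [|i /negPf ->]; last by rewrite powR0// gt_eqF.
rewrite (eq_bigr (fun _ => n%:R^-1)) => [|i ->]; last first.
  by rewrite -powRrM mulNr mulVf ?gt_eqF// powR_inv1.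
rewrite (big_ord_narrow nd)/= sumr_const card_ord.
by rewrite -[leLHS]mulr_natl divff// pnatr_eq0 -lt0n.
Qed.

Lemma lpnormy_coord_dual sg : lpnorm +oo (coord_dual 1 sg) <= 1.
Proof.
apply/bigmax_leP; split=> // j _; rewrite normr_coord_dual//.
by case: ifP.
Qed.

End CoordinateFamily.

Section Hartley.
Variable R : realType.
Implicit Types (m : nat) (t : R).

Lemma sin_natM0 t m : sin t = 0 -> sin (m%:R * t) = 0.
Proof.
move=> t0; elim: m => [|m IHm]; first by rewrite mul0r sin0.
by rewrite -natr1 mulrDl mul1r sinD IHm t0 mul0r mulr0 addr0.
Qed.

Section Sums.
Variables (d m : nat).
Hypothesis d_gt0 : (0 < d)%N.
Let phi : R := pi * m%:R / d%:R.
Let dN0 : d%:R != 0 :> R. Proof. by rewrite pnatr_eq0 -lt0n. Qed.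

Let dphi : d%:R * (2 * phi) - phi = - phi + pi *+ 2 *+ m.
Proof. by rewrite -[_ *+ m]mulr_natl -[pi *+ 2]mulr_natl /phi; field. Qed.

(** Multiplied by the sine of half the step, the sum telescopes; both ends agree by
    periodicity. *)
Lemma sum_cos_eq0 : (0 < m < d)%N -> \sum_(j < d) cos (j%:R * (2 * phi)) = 0.
Proof.
move=> /andP[m0 md].
have s0 : 0 < sin phi.
  rewrite sin_gt0_pi// /phi divr_gt0 ?mulr_gt0 ?pi_gt0 ?ltr0n//=.
  by rewrite ltr_pdivrMr ?ltr0n// ltr_pM2l ?pi_gt0// ltr_nat.
apply/eqP; rewrite -(mulrI_eq0 _ (mulfI (lt0r_neq0 s0))) mulr_sumr; apply/eqP.
pose F j := sin (j%:R * (2 * phi) - phi) / 2.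
rewrite (eq_bigr (fun j : 'I_d => F j.+1 - F j)) => [|j _]; last first.
  rewrite /F -[j.+1%:R]natr1 [(j%:R + 1) * _]mulrDl mul1r.
  have -> : j%:R * (2 * phi) + 2 * phi - phi = j%:R * (2 * phi) + phi by ring.
  by rewrite sinD sinB; field.
rewrite -(big_mkord xpredT (fun j => F j.+1 - F j)) telescope_sumr//.
by rewrite /F dphi (periodicn (@sinD2pi R)) mul0r sub0r subrr.
Qed.

(** As for the cosines when the sine of half the step is nonzero; otherwise every
    term is 0. *)
Lemma sum_sin_eq0 : \sum_(j < d) sin (j%:R * (2 * phi)) = 0.
Proof.
have [s0|s0] := eqVneq (sin phi) 0.
  by rewrite big1// => j _; rewrite mulrA -natrM sin_natM0.
apply/eqP; rewrite -(mulrI_eq0 _ (mulfI s0)) mulr_sumr; apply/eqP.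
pose F j := - cos (j%:R * (2 * phi) - phi) / 2.
rewrite (eq_bigr (fun j : 'I_d => F j.+1 - F j)) => [|j _]; last first.
  rewrite /F -[j.+1%:R]natr1 [(j%:R + 1) * _]mulrDl mul1r.
  have -> : j%:R * (2 * phi) + 2 * phi - phi = j%:R * (2 * phi) + phi by ring.
  by rewrite cosD cosB; field.
rewrite -(big_mkord xpredT (fun j => F j.+1 - F j)) telescope_sumr//.
by rewrite /F dphi (periodicn (@cosD2pi R)) mul0r sub0r subrr.
Qed.

End Sums.

Variable d : nat.
Hypothesis d_gt0 : (0 < d)%N.

(** A row of the discrete Hartley transform. These rows are orthogonal, and their
    entries are bounded independently of [d], for every dimension [d]. *)
Definition cas (i : nat) : 'rV[R]_d :=
  \row_j (cos (j%:R * (2 * (pi * i%:R / d%:R))) +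
          sin (j%:R * (2 * (pi * i%:R / d%:R)))).

Lemma normr_cas_le i j : `|cas i 0 j| <= 2.
Proof.
rewrite mxE (le_trans (ler_normD _ _))//.
by apply: (@le_trans _ _ (1 + 1)); [apply: lerD; [exact: cos_max|exact: sin_max]|lra].
Qed.

(** The product of two entries is cos (x - y) + sin (x + y). *)
Lemma dot_cas i i' : (i < d)%N -> (i' < d)%N ->
  dot (cas i) (cas i') = if i == i' then d%:R else 0.
Proof.
wlog ii' : i i' / (i' <= i)%N => [hw|] id i'd.
  have [|/ltnW] := leqP i' i; first by move/hw; exact.
  by move/hw => /(_ i'd id); rewrite dotC eq_sym.
have -> : dot (cas i) (cas i') =
    \sum_(j < d) cos (j%:R * (2 * (pi * (i - i')%:R / d%:R))) +
    \sum_(j < d) sin (j%:R * (2 * (pi * (i + i')%:R / d%:R))).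
  rewrite -big_split/=; apply: eq_bigr => j _; rewrite !mxE.
  rewrite natrB// natrD.
  have -> : j%:R * (2 * (pi * (i%:R - i'%:R) / d%:R)) =
     j%:R * (2 * (pi * i%:R / d%:R)) - j%:R * (2 * (pi * i'%:R / d%:R)) :> R by ring.
  have -> : j%:R * (2 * (pi * (i%:R + i'%:R) / d%:R)) =
     j%:R * (2 * (pi * i%:R / d%:R)) + j%:R * (2 * (pi * i'%:R / d%:R)) :> R by ring.
  by rewrite cosB sinD; ring.
rewrite sum_sin_eq0// addr0; have [->|ne] := eqVneq i i'.
  rewrite subnn (eq_bigr (fun=> 1)) => [|j _]; first by rewrite sumr_const card_ord.
  by rewrite !(mulr0, mul0r) cos0.
rewrite sum_cos_eq0// subn_gt0 ltn_neqAle eq_sym ne ii'/=.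
exact: leq_ltn_trans (leq_subr _ _) id.
Qed.

Section Family.
Variables (n : nat) (nd : (n <= d)%N) (n_gt0 : (0 < n)%N).
Variable r : R.
Hypotheses (r1 : 1 <= r) (r2 : r < 2).
Let r0 : 0 < r. Proof. exact: lt_le_trans r1. Qed.
Let dR0 : 0 < d%:R :> R. Proof. by rewrite ltr0n. Qed.
Let nR0 : 0 < n%:R :> R. Proof. by rewrite ltr0n. Qed.

(** The scaling puts these vectors in the unit ball of the dual norm of l_r. *)
Definition hartley_family (i : 'I_n) : 'rV[R]_d := (d%:R `^ (r^-1 - 1) / 4) *: cas i.

Definition hartley_dual (sg : 'I_n -> bool) : 'rV[R]_d :=
  (2 * d%:R `^ r^-1 * Num.sqrt n%:R)^-1 *: \sum_i (-1) ^+ nat_of_bool (sg i) *: cas i.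

(** The power mean inequality up to a factor 2, from [x <= 1 + x ^ r] applied to the
    coordinates divided by their l_r mean. *)
Lemma sum_normr_le (h : 'rV[R]_d) :
  \sum_i `|h 0 i| <= 2 * d%:R `^ (1 - r^-1) * lpnorm r%:E h.
Proof.
have rle1 : (1 <= r%:E)%E by rewrite lee_fin.
have N0 := lpnorm_ge0 r%:E h; have [N_eq0|N_neq0] := eqVneq (lpnorm r%:E h) 0.
  have -> : h = 0 by apply: (lpnorm_eq0 rle1); rewrite N_eq0.
  by rewrite big1 ?mulr_ge0 ?powR_ge0 ?lpnorm_ge0// => i _; rewrite mxE normr0.
have NS := lpnorm_powR h r0.
move: (lpnorm r%:E h) N0 N_neq0 NS => N N0 N_neq0 NS.
have {N_neq0}N0 : 0 < N by rewrite lt0r N_neq0.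
set H := N * d%:R `^ - r^-1.
have H0 : 0 < H by rewrite mulr_gt0// powR_gt0.
have -> : 2 * d%:R `^ (1 - r^-1) * N = H * (2 * d%:R).
  by rewrite /H powRD ?(gt_eqF dR0) ?implybT// powRr1 ?(ltW dR0)//; ring.
rewrite -ler_pdivrMl// mulr_sumr.
apply: (@le_trans _ _ (\sum_(i < d) (1 + (H^-1 * `|h 0 i|) `^ r))).
  apply: ler_sum => i _; set x := H^-1 * _.
  have x0 : 0 <= x by rewrite mulr_ge0// invr_ge0 ltW.
  have [x1|/ltW x1] := leP x 1; first by rewrite (le_trans x1)// lerDl powR_ge0.
  by rewrite (le_trans (le1r_powR x1 r1))// lerDr.
rewrite big_split/= sumr_const card_ord.
under eq_bigr do rewrite powRM ?invr_ge0 ?(ltW H0)//.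
rewrite -mulr_sumr -NS /H -powRM ?invr_ge0 ?(ltW H0) ?(ltW N0)//.
have -> : (N * d%:R `^ - r^-1)^-1 * N = d%:R `^ r^-1.
  by rewrite powRN invfM invrK; field; rewrite gt_eqF.
rewrite powRVK ?(ltW dR0)//; lra.
Qed.

Lemma normr_dot_hartley i (h : 'rV[R]_d) : `|dot (hartley_family i) h| <= lpnorm r%:E h.
Proof.
rewrite dotZl normrM ger0_norm ?divr_ge0 ?powR_ge0//.
have hb : `|dot (cas i) h| <= 2 * \sum_j `|h 0 j|.
  apply: (le_trans (ler_norm_sum _ _ _)); rewrite mulr_sumr; apply: ler_sum => j _.
  by rewrite normrM ler_wpM2r// normr_cas_le.
have c0 : 0 <= d%:R `^ (r^-1 - 1) / 4 :> R by rewrite divr_ge0 ?powR_ge0.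
apply: (le_trans (ler_wpM2l c0 hb)).
have := ler_wpM2l c0 (ler_wpM2l (ler0n _ 2) (sum_normr_le h)).
move=> /le_trans; apply; rewrite le_eqVlt; apply/orP; left; apply/eqP.
have -> : d%:R `^ (r^-1 - 1) / 4 * (2 * (2 * d%:R `^ (1 - r^-1) * lpnorm r%:E h)) =
  (d%:R `^ (r^-1 - 1) * d%:R `^ (1 - r^-1)) * lpnorm r%:E h by field.
by rewrite -powRD ?(gt_eqF dR0) ?implybT// addrA subrK subrr powRr0 mul1r.
Qed.

Lemma dot_cas_signed sg (i : 'I_n) :
  dot (cas i) (\sum_i' (-1) ^+ nat_of_bool (sg i') *: cas (i' : 'I_n)) =
  (-1) ^+ nat_of_bool (sg i) * d%:R.
Proof.
have lt_d (i' : 'I_n) : (i' < d)%N by exact: leq_trans (ltn_ord i') nd.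
rewrite dotC dot_suml (bigD1 i)//= dotZl dot_cas// eqxx big1 ?addr0// => i' ii'.
by rewrite dotZl dot_cas// (inj_eq val_inj) (negPf ii') mulr0.
Qed.

Lemma dot_hartley_dual sg i :
  dot (hartley_family i) (hartley_dual sg) =
  (-1) ^+ nat_of_bool (sg i) * (8 * Num.sqrt n%:R)^-1.
Proof.
rewrite dotZl dotZr dot_cas_signed powRD ?(gt_eqF dR0) ?implybT//.
rewrite powRN powRr1 ?(ltW dR0)//.
by field; rewrite !gt_eqF ?sqrtr_gt0 ?powR_gt0.
Qed.

(** By orthogonality the l_2 norm of the signed sum is [sqrt (n * d)]; the passage to
    the l_r norm, [r < 2], uses [x ^ r <= 1 + x ^ 2] for the coordinates divided by
    [sqrt n]. *)
Lemma lpnorm_hartley_dual sg : lpnorm r%:E (hartley_dual sg) <= 1.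
Proof.
have rle1 : (1 <= r%:E)%E by rewrite lee_fin.
have sn0 : 0 < Num.sqrt (n%:R : R) by rewrite sqrtr_gt0.
rewrite lpnormZ// gtr0_norm; last by rewrite invr_gt0 !mulr_gt0 ?powR_gt0.
rewrite ler_pdivrMl; last by rewrite !mulr_gt0 ?powR_gt0.
rewrite mulr1; set v := \sum_i _.
apply: lpnorm_le; rewrite ?mulr_ge0 ?powR_ge0 ?(ltW sn0)//.
have v2 : \sum_j (v 0 j) ^+ 2 = n%:R * d%:R.
  have -> : \sum_j (v 0 j) ^+ 2 = dot v v by apply: eq_bigr => j _; rewrite expr2.
  rewrite {1}/v dot_suml (eq_bigr (fun=> d%:R)) => [|i _].
    by rewrite sumr_const card_ord -[LHS]mulr_natl.
  by rewrite dotZl dot_cas_signed mulrA -signr_addb addbb mul1r.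
have term j : `|v 0 j| `^ r <=
    Num.sqrt n%:R `^ r * (1 + (v 0 j) ^+ 2 / n%:R).
  have -> : `|v 0 j| = Num.sqrt n%:R * (`|v 0 j| / Num.sqrt n%:R).
    by field; rewrite gt_eqF.
  have -> : (v 0 j) ^+ 2 / n%:R = (`|v 0 j| / Num.sqrt n%:R) ^+ 2.
    by rewrite exprMn exprVn sqr_sqrtr ?(ltW nR0)// real_normK// num_real.
  set x := `|v 0 j| / _; have x0 : 0 <= x by rewrite divr_ge0 ?(ltW sn0).
  rewrite powRM ?(ltW sn0)// ler_wpM2l ?powR_ge0//.
  have [x1|/ltW x1] := leP x 1.
    rewrite (@le_trans _ _ 1) ?lerDl ?sqr_ge0//.
    have <- : 1 `^ r = 1 :> R by rewrite powR1.
    by apply: ge0_ler_powR; rewrite ?nnegrE// ltW.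
  rewrite -powR_mulrn// (le_trans (ler_powR x1 (ltW r2)))// lerDr//.
apply: (le_trans (ler_sum _ (fun j _ => term j))).
rewrite -mulr_sumr big_split/= sumr_const card_ord -mulr_suml v2.
rewrite [n%:R * _ / _]mulrAC divff ?gt_eqF// mul1r.
rewrite !powRM ?mulr_ge0 ?powR_ge0 ?(ltW sn0)// powRVK ?(ltW dR0)//.
rewrite mulrC ler_wpM2r ?powR_ge0// -mulr2n -[_ *+ 2]mulr_natl ler_wpM2r ?(ltW dR0)//.
by rewrite le1r_powR// ler1n.
Qed.

End Family.
End Hartley.

(** * Constants and exponents *)

Section Constants.
Variables (R : realType) (kappa : R).
Hypothesis hkappa : 1 < kappa <= 2.
Let a := kappa - 1.
Let e : R := expR 1.

(** The factor after 64 collects what is lost in the smoothness constant through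
    [k.+1 <= 4 * M], [2 n + 1 <= 3 n] and [K0 <= e]; the factor 64 comes from
    [nu >= 1 / 8] and [kappa <= 2]. *)
Definition gap_const : R := 64 * (2 * e * (36 * e) `^ a).
Definition rate_const : R := (gap_const `^ a^-1)^-1 / 2.

Let a_gt0 : 0 < a. Proof. by case/andP: hkappa; rewrite /a; lra. Qed.
Let e_ge1 : 1 <= e. Proof. by rewrite /e -expR0 ler_expR. Qed.

Lemma gap_const_ge1 : 1 <= gap_const.
Proof.
have e1 := e_ge1.
have : 1 <= (36 * e) `^ a.
  by rewrite -[leLHS](powRr0 (36 * e)); apply: ler_powR; [lra|exact: ltW].
rewrite /gap_const; nra.
Qed.

Lemma rate_const_gt0 : 0 < rate_const.
Proof.
by rewrite divr_gt0// invr_gt0 powR_gt0// (lt_le_trans _ gap_const_ge1).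
Qed.

(** One constant serves all [p]: the exponent [theta] is never below [kappa - 1], and
    [gap_const >= 1]. *)
Lemma gap_rate_const theta : a <= theta -> gap_const * (2 * rate_const) `^ theta <= 1.
Proof.
move=> athe; have C1 := gap_const_ge1; have C0 : 0 < gap_const by lra.
have -> : 2 * rate_const = gap_const `^ - a^-1.
  by rewrite /rate_const powRN; field; rewrite gt_eqF// powR_gt0.
rewrite -powRrM -{1}(powRr1 (ltW C0)) -powRD ?(gt_eqF C0) ?implybT//.
rewrite -[leRHS](powRr0 gap_const) ler_powR// mulNr subr_le0.
by rewrite ler_pdivlMl// mulr1.
Qed.

Lemma ex_nat_ceil (x : R) : 0 < x -> exists n : nat, x <= n%:R < x + 1.
Proof.
move=> x0; have [xt|xt] := eqVneq x (Num.truncn x)%:R.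
  by exists (Num.truncn x); rewrite -xt lexx ltrDl ltr01.
have /andP[t1 t2] := truncn_itv (ltW x0).
exists (Num.truncn x).+1; rewrite (ltW t2)/= -natr1 ltrD2r.
by rewrite lt_neqAle eq_sym xt.
Qed.

(** With [n] between [rate_const * B] and twice that, the gradient condition of
    [complexity_ge_of_family] reduces to [gap_const * n ^ theta < X], where [theta]
    collects the powers of [n]: [kappa - 1] from the smoothing range and
    [kappa * iq] from [mu ^ kappa]. *)
Lemma complexity_ge (d : nat) (p : \bar R) (L Rad eps M K0 nu iq : R) (k : nat)
    (V : Type) (O : ('rV[R]_d -> R) -> 'rV[R]_d -> V) :
  (1 <= p)%E -> 0 < L -> 0 < Rad -> 0 < eps -> 0 < M ->
  k.+1%:R <= 4 * M -> 0 < K0 <= e -> 8^-1 <= nu -> 0 <= iq ->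
  local_oracle (weakly_smooth_convex p kappa L) O ->
  (forall n, (0 < n <= d)%N -> exists z : 'I_n -> 'rV[R]_d,
    (forall h, \sum_i dot (z i) h ^+ (k.+1).*2 <= (K0 * lpnorm p h) ^+ (k.+1).*2) /\
    (forall sg : 'I_n -> bool, exists w, lpnorm p w <= 1 /\
      forall i, dot (z i) w = (-1) ^+ nat_of_bool (sg i) * (nu * n%:R `^ - iq))) ->
  let B := (L * Rad `^ (kappa - 1) / (eps * M `^ (kappa - 1)))
             `^ (kappa - 1 + kappa * iq)^-1 in
  rate_const^-1 <= B -> rate_const * B <= d%:R ->
  ((rate_const * B)%:E <= oracle_complexity p
    (weakly_smooth_convex p kappa L `&` min_attained_in_ball p Rad) O eps)%E.
Proof.
move=> p1 L0 Rad0 eps0 M0 kM /andP[K00 K0e] nu8 iq0 locO fam B NB Bd.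
have [k1 k2] := andP hkappa; have r0 := rate_const_gt0.
set X := L * Rad `^ (kappa - 1) / (eps * M `^ (kappa - 1)) in B NB Bd *.
set theta := kappa - 1 + kappa * iq in B NB Bd *.
have theta_a : a <= theta by rewrite lerDl mulr_ge0//; lra.
have theta0 : 0 < theta by exact: lt_le_trans theta_a.
have X0 : 0 < X by rewrite divr_gt0 ?mulr_gt0 ?powR_gt0.
have B0 : 0 < B by rewrite powR_gt0.
have cB1 : 1 <= rate_const * B by rewrite -ler_pdivrMl// mulr1.
have [n /andP[xn nx]] : exists n : nat, rate_const * B <= n%:R < rate_const * B + 1.
  by apply: ex_nat_ceil; lra.
have n1 : 1 <= n%:R :> R by lra.
have n0 : (0 < n)%N by rewrite -(ler_nat R).
have nd : (n <= d)%N by rewrite -ltnS -(ltr_nat R) -natr1; lra.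
have nR0 : 0 < n%:R :> R by lra.
have [|z [emb dual_w]] := fam n; first by rewrite n0.
apply: (@le_trans _ _ n%:R%:E); first by rewrite lee_fin.
have nu0 : 0 < nu by lra.
set mu := nu * n%:R `^ - iq in dual_w.
have mu0 : 0 < mu by rewrite mulr_gt0 ?powR_gt0.
apply: (complexity_ge_of_family p1 hkappa L0 Rad0 mu0 K00 locO emb dual_w).
(* [n < 2 * rate_const * B], and the constants absorb the factor. *)
have nX : gap_const * n%:R `^ theta < X.
  have XB : X = B `^ theta by rewrite -powRrM mulVf ?gt_eqF// powRr1// ltW.
  apply: (@lt_le_trans _ _ (gap_const * (2 * rate_const * B) `^ theta)).
    rewrite ltr_pM2l ?(lt_le_trans _ gap_const_ge1)//.
    by apply: gt0_ltr_powR; rewrite ?nnegrE//; lra.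
  have c0 : 0 <= 2 * rate_const by lra.
  rewrite (powRM _ c0 (ltW B0)) mulrA -XB.
  by rewrite ler_piMl ?(ltW X0)// gap_rate_const.
have mu_kappa : n%:R `^ (- (kappa * iq)) / 64 <= mu * mu `^ a.
  rewrite /a mulr_powRB1 ?(ltW mu0)//; last by lra.
  rewrite /mu powRM ?powR_ge0 ?(ltW nu0)// -powRrM mulNr [iq * _]mulrC [leLHS]mulrC.
  rewrite ler_wpM2r ?powR_ge0//.
  apply: (@le_trans _ _ (8^-1 `^ kappa)).
    have -> : 64^-1 = 8^-1 `^ 2%:R :> R by rewrite powR_mulrn//; field.
    apply: ger_powR => //; apply/andP; split; lra.
  by apply: ge0_ler_powR; rewrite ?nnegrE ?(ltW nu0)//; lra.
clearbody mu.
have e0 : 0 < e := lt_le_trans ltr01 e_ge1.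
set Y := 36 * e * M * n%:R / (Rad * mu).
have Y0 : 0 < Y by rewrite divr_gt0// mulr_gt0// ?mulr_gt0.
have denY : 2 * K0 * (3 * k.+1%:R * K0 * n.*2.+1%:R / (Rad * mu)) `^ (kappa - 1) <=
    2 * e * Y `^ a.
  apply: ler_pM; rewrite ?mulr_ge0 ?powR_ge0 ?(ltW K00)//; first by lra.
  apply: ge0_ler_powR; rewrite ?nnegrE ?(ltW a_gt0) ?(ltW Y0)//.
    by rewrite divr_ge0 ?mulr_ge0 ?(ltW K00) ?(ltW Rad0) ?(ltW mu0).
  rewrite /Y ler_wpM2r ?invr_ge0 ?mulr_ge0 ?(ltW Rad0) ?(ltW mu0)//.
  have -> : 36 * e * M * n%:R = (3 * (4 * M)) * e * (3 * n%:R) by ring.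
  apply: ler_pM; rewrite ?mulr_ge0 ?(ltW K00)//.
    by apply: ler_pM; rewrite ?mulr_ge0 ?(ltW K00)// ler_wpM2l.
  by rewrite -natr1 -muln2 natrM; lra.
have den0 : 0 < 2 * e * Y `^ a.
  by rewrite !mulr_gt0// powR_gt0.
apply: (@lt_le_trans _ _ (mu * (L / (2 * e * Y `^ a)))); last first.
  rewrite ler_pM2l// ler_pM2l// lef_pV2// posrE.
  rewrite !mulr_gt0// powR_gt0// divr_gt0 ?mulr_gt0//.
rewrite mulrA ltr_pdivlMr//.
have YE : Y `^ a * (Rad `^ a * mu `^ a) = (36 * e) `^ a * M `^ a * n%:R `^ a.
  have RM0 : 0 < Rad * mu by rewrite mulr_gt0.
  have e36 : 0 < 36 * e by rewrite mulr_gt0.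
  have eM : 0 < 36 * e * M by rewrite mulr_gt0.
  rewrite -(powRM _ (ltW Rad0) (ltW mu0)) -(powRM _ (ltW Y0) (ltW RM0)).
  rewrite -(powRM _ (ltW e36) (ltW M0)) -(powRM _ (ltW eM) (ltW nR0)).
  by rewrite /Y divfK// gt_eqF.
have W0 : 0 < Rad `^ a * mu `^ a by rewrite mulr_gt0 ?powR_gt0.
rewrite -(ltr_pM2r W0).
have -> : eps * (2 * e * Y `^ a) * (Rad `^ a * mu `^ a) =
    eps * (2 * e) * (Y `^ a * (Rad `^ a * mu `^ a)) by ring.
rewrite YE.
have -> : eps * (2 * e) * ((36 * e) `^ a * M `^ a * n%:R `^ a) =
    eps * M `^ a * gap_const / 64 * n%:R `^ a.
  by rewrite /gap_const; field.
have -> : mu * L * (Rad `^ a * mu `^ a) = L * Rad `^ a * (mu * mu `^ a) by ring.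
have LR0 : 0 < L * Rad `^ a by rewrite mulr_gt0 ?powR_gt0.
apply: lt_le_trans (ler_wpM2l (ltW LR0) mu_kappa).
have -> : n%:R `^ a = n%:R `^ theta * n%:R `^ (- (kappa * iq)).
  by rewrite -powRD ?(gt_eqF nR0) ?implybT// /theta addrK.
have -> : eps * M `^ a * gap_const / 64 * (n%:R `^ theta * n%:R `^ (- (kappa * iq))) =
  (gap_const * n%:R `^ theta) * (eps * M `^ a) *
  (n%:R `^ (- (kappa * iq)) / 64) by ring.
rewrite ltr_pM2r ?divr_gt0 ?powR_gt0//.
by move: nX; rewrite /X ltr_pdivlMr// mulr_gt0 ?powR_gt0.
Qed.

End Constants.

(** * The three regimes *)

Section Exponent.
Variables (R : realType) (d : nat).
Hypothesis d2 : (2 <= d)%N.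

(** e ^ (- 1 / 2) >= 1 - 1 / 2. *)
Lemma half_le_ln : 2^-1 <= ln d%:R :> R.
Proof.
apply: (@le_trans _ _ (ln 2)); last by rewrite ler_ln ?posrE ?ler_nat ?ltr0n// ltnW.
rewrite -[leLHS](@expRK R) ler_ln ?posrE ?expR_gt0//.
have := expR_ge1Dx (- 2^-1 : R); rewrite expRN.
have -> : 1 + - 2^-1 = 2^-1 :> R by field.
by rewrite lef_pV2 ?posrE ?expR_gt0.
Qed.

Lemma truncn_ln_le : (Num.truncn (ln d%:R : R)).+1%:R <= 4 * ln d%:R :> R.
Proof.
have h := half_le_ln; have h0 : 0 <= ln d%:R :> R by lra.
have /andP[t1 _] := truncn_itv h0.
rewrite -natr1; lra.
Qed.

Lemma le_expR_truncn n : (n <= d)%N ->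
  n%:R <= expR 1 ^+ ((Num.truncn (ln d%:R : R)).+1).*2 :> R.
Proof.
move=> nd; have dR0 : 0 < d%:R :> R by rewrite ltr0n ltnW.
have h := half_le_ln; have h0 : 0 <= ln d%:R :> R by lra.
have /andP[_ t2] := truncn_itv h0.
apply: (@le_trans _ _ (expR (ln d%:R))); first by rewrite lnK ?posrE// ler_nat.
by rewrite -expRM_natl mulr1 ler_expR (le_trans (ltW t2))// ler_nat -addnn leq_addr.
Qed.

End Exponent.

Theorem corollary2 (R : realType) (kappa : R) (hkappa : 1 < kappa <= 2) :
  exists c N : R, [/\ 0 < c, 0 < N &
    forall (d : nat) (p : \bar R) (L Rad eps : R) (V : lmodType R)
      (O : ('rV[R]_d -> R) -> 'rV[R]_d -> V),
    (2 <= d)%N -> (1 <= p)%E -> 0 < L -> 0 < Rad -> 0 < eps ->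
    local_oracle (weakly_smooth_convex p kappa L) O ->
    let complexity := oracle_complexity p
      (weakly_smooth_convex p kappa L `&` min_attained_in_ball p Rad) O eps in
    let bounded_below_by (B : R) :=
      N <= B -> c * B <= d%:R -> ((c * B)%:E <= complexity)%E in
    [/\ (p < 2%:E)%E ->
          bounded_below_by
            ((L * Rad `^ (kappa - 1) / (eps * ln d%:R `^ (kappa - 1)))
               `^ (2 / (3 * kappa - 2))),
        forall q : R, p = q%:E -> 2 <= q ->
          bounded_below_by
            ((L * Rad `^ (kappa - 1)
                / (eps * Num.min q (ln d%:R) `^ (kappa - 1)))
               `^ (q / (kappa * q + kappa - q))) &
        p = +oo%E ->
          bounded_below_by
            ((L * Rad `^ (kappa - 1) / (eps * ln d%:R `^ (kappa - 1)))
               `^ (1 / (kappa - 1)))]].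
Proof.
have /andP[k1 k2] := hkappa; have c0 := rate_const_gt0 hkappa.
exists (rate_const kappa), (rate_const kappa)^-1; split; rewrite ?invr_gt0//.
move=> d p L Rad eps V O d2 p1 L0 Rad0 eps0 locO complexity bounded.
have ln0 : 0 < ln d%:R :> R by have := half_le_ln R d2; lra.
have e1 : 1 <= expR 1 :> R by rewrite -expR0 ler_expR.
have Ke : 0 < (expR 1 : R) <= expR 1 by rewrite expR_gt0 lexx.
have d0 : (0 < d)%N by exact: ltnW.
split.
(* Case p < 2: Hartley vectors, mu of order n^(-1/2). *)
- case: p p1 locO @complexity @bounded => [r| |]// r1 locO complexity bounded.
  rewrite lte_fin => r2 NB Bd.
  have r1' : 1 <= r by rewrite -lee_fin.
  have expE : 2 / (3 * kappa - 2) = (kappa - 1 + kappa * 2^-1)^-1.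
    by field; rewrite !gt_eqF//; lra.
  rewrite expE in NB Bd *.
  apply: (complexity_ge hkappa r1 L0 Rad0 eps0 ln0 (truncn_ln_le R d2) Ke
    (lexx _) _ locO _ NB Bd) => // n /andP[n0 nd].
  exists (hartley_family d r (n := n)); split=> [h|sg].
    by apply: sum_dot_le (le_expR_truncn R d2 nd) _; [exact: expR_ge0|
      move=> i; exact: normr_dot_hartley].
  exists (hartley_dual d r sg); split; first exact: lpnorm_hartley_dual.
  by move=> i; rewrite dot_hartley_dual// powRN powR12_sqrt// invfM.
(* Case 2 <= p < oo: canonical basis, mu = n^(-1/p), and 2k+2 >= p if p <= ln d. *)
- move=> q pq q2 NB Bd; subst p.
  have q1 : 1 <= q by lra.
  have expE : q / (kappa * q + kappa - q) = (kappa - 1 + kappa * q^-1)^-1.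
    by field; rewrite !gt_eqF//; nra.
  rewrite expE in NB Bd *.
  have nu1 : 8^-1 <= 1 :> R by lra.
  have q0 : 0 <= q^-1 by rewrite invr_ge0; lra.
  have dual n (nd : (n <= d)%N) (sg : 'I_n -> bool) : (0 < n)%N ->
      exists w : 'rV[R]_d, lpnorm q%:E w <= 1 /\
      forall i, dot (coord_family R nd i) w =
        (-1) ^+ nat_of_bool (sg i) * (1 * n%:R `^ - q^-1).
    move=> n0; exists (coord_dual d (n%:R `^ - q^-1) sg); split.
      by apply: lpnorm_coord_dual => //; lra.
    by move=> i; rewrite dot_coord_dual mul1r.
  have [qln|/ltW lnq] := leP q (ln d%:R).
    rewrite (min_idPl qln) in NB Bd *.
    have qk : (Num.truncn q).+1%:R <= 4 * q.
      have /andP[t1 _] := truncn_itv (le_trans ler01 q1).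
      by rewrite -natr1; lra.
    have K1 : 0 < (1 : R) <= expR 1 by rewrite ltr01.
    have q0' : 0 < q by lra.
    apply: (complexity_ge hkappa p1 L0 Rad0 eps0 q0' qk K1 nu1 q0 locO _ NB Bd).
    move=> n /andP[n0 nd]; exists (coord_family R nd); split=> [h|sg].
      apply: sum_coord_le => //.
      have /andP[_ t2] := truncn_itv (le_trans ler01 q1).
      by rewrite (le_trans (ltW t2))// ler_nat -addnn leq_addr.
    exact: dual.
  rewrite (min_idPr lnq) in NB Bd *.
  apply: (complexity_ge hkappa p1 L0 Rad0 eps0 ln0 (truncn_ln_le R d2) Ke
    nu1 q0 locO _ NB Bd).
  move=> n /andP[n0 nd]; exists (coord_family R nd); split=> [h|sg].
    apply: sum_dot_le (le_expR_truncn R d2 nd) _; first exact: expR_ge0.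
    by move=> i; rewrite dot_coord coord_le_lpnorm.
  exact: dual.
(* Case p = oo: canonical basis, mu = 1. *)
- move=> py NB Bd; subst p.
  have expE : 1 / (kappa - 1) = (kappa - 1 + kappa * 0)^-1.
    by rewrite mulr0 addr0 div1r.
  rewrite expE in NB Bd *.
  have nu1 : 8^-1 <= 1 :> R by lra.
  apply: (complexity_ge hkappa p1 L0 Rad0 eps0 ln0 (truncn_ln_le R d2) Ke
    nu1 (lexx _) locO _ NB Bd).
  move=> n /andP[n0 nd]; exists (coord_family R nd); split=> [h|sg].
    apply: sum_dot_le (le_expR_truncn R d2 nd) _; first exact: expR_ge0.
    by move=> i; rewrite dot_coord coord_le_lpnorm.
  exists (coord_dual d 1 sg); split; first exact: lpnormy_coord_dual.
  by move=> i; rewrite dot_coord_dual oppr0 powRr0 mulr1.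
Qed.
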